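(* For any sequence of operations on one-root hollow heaps (as defined and implemented in the context), starting with no heaps, the amortized time per operation is $O(1)$ for each operation other than delete and delete-min, and $O(\log N)$ for each delete or delete-min on a heap of $N$ nodes (full and hollow).
   Context: Heaps. A heap stores a finite set of items, each with a key from a totally ordered universe, and supports: make-heap() (return an empty heap); find-min($h$) (return an item of minimum key in $h$, or null if $h$ is empty); insert($e,k,h$) (add item $e$, which is in no heap, with key $k$); delete-min($h$) (delete from non-empty $h$ the item that find-min($h$) returns); meld($h_1,h_2$) (return a heap containing all items of the item-disjoint heaps $h_1,h_2$); decrease-key($e,k,h$) (given an item $e$ in $h$ with key greater than $k$, change its key to $k$); delete($e,h$) (delete item $e$ from $h$). Heaps passed as arguments are destroyed; decrease-key and delete are given the location of $e$. Nodes. Nodes hold items: each node holds at most one item, and is full if it holds one and hollow otherwise; each item in a heap is held by exactly one node; a newly created node is full and a hollow node never becomes full again. Each node $u$ has a key $u.key$ (the current key of its item if $u$ is full; if $u$ is hollow, the key its item had just before leaving $u$) and a non-negative integer rank $u.rank$. A tree (or dag) of nodes with arcs from parent to child is heap-ordered if $v.key\le w.key$ for every arc $(v,w)$. For two full roots, link makes the one of larger key (ties broken arbitrarily) a child of the other; the new child is the loser and the other the winner. A ranked link is a link of two roots of equal rank and increases the winner's rank by one; an unranked link may be applied to any two full roots and changes no ranks. One-root hollow heap. It is either empty or a single heap-ordered rooted tree of nodes whose root is full; the root is the minimum node. A non-root node is a ranked or unranked child according to whether the link it lost was ranked or unranked; a child keeps this status when moved to a new parent. make-heap returns an empty heap;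 find-min returns the item in the root; meld returns one heap if the other is empty, and otherwise does an unranked link of the two roots; insert($e,k,h$) creates a new full node of rank 0 holding $e$ with key $k$ and melds this one-node heap with $h$. decrease-key($e,k,h$), with $u$ the node holding $e$: if $u$ is the root one may simply set $u.key=k$; otherwise create a new node $v$, move $e$ from $u$ to $v$ (so $u$ becomes hollow), set $v.key=k$ and $v.rank=\max\{0,u.rank-2\}$, move to $v$ every ranked child of $u$ of rank less than $v.rank$ and any subset of the unranked children of $u$ (with their subtrees), and meld the tree rooted at $v$ with the heap. delete($e,h$) removes $e$ from the node $u$ holding it, making $u$ hollow; if $u$ is not the root this completes the operation; otherwise, while some root is hollow, destroy such a root, making its children roots; then do ranked links while two roots have equal rank; then do unranked links until one root remains. delete-min($h$) performs delete on the item in the root. Implementation. The children of each node are kept in a singly-linked circular list accessed via its last element, with the ranked children first in decreasing order by rank followed by the unranked children: a ranked link adds the loser at the front of the winner's list, an unranked link at the back. A decrease-key moving an item from $u$ to $v$ moves to $v$ all but the first two children of $u$ (with their subtrees) if $u.rank>2$, and no children otherwise. During delete, roots of equal rank to be linked are found using an array of roots indexed by rank. *)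

(* Defs.v *)
From mathcomp Require Import all_boot all_order.
Set Implicit Arguments.
Unset Strict Implicit.
Unset Printing Implicit Defensive.

(* One-root hollow heaps, run on a pointer machine.  Every transition of the
   machine ([invoke], the beginning of an operation, and [step], the loops of a
   deletion) reads and writes a bounded number of node fields, array cells and
   variables and does at most one key comparison, so that, up to a constant
   factor, time is the number of transitions.  The choices that the data
   structure leaves open (the address of a new node, ties, the order in which
   the roots are treated in a deletion) are nondeterministic. *)

Definition upd (A : eqType) (B : Type) (f : A -> B) (a : A) (b : B) : A -> B :=
  fun x => if x == a then b else f x.

Definition loc := nat.
Definition handle := nat.

Notation "'let*' x := e 'in' f" := (obind (fun x => f) e)
  (at level 200, x name, e at level 100, f at level 200).

Section HollowHeap.
Context {disp : Order.disp_t} {K : orderType disp} {I : eqType}.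

(* The children of a node form a singly-linked circular list through [next];
   [last] points to the last of them, and is [None] if there are none.  The
   field [next] of a root is meaningless. *)
Record node := Node {
  item : option I;
  key : K;
  rank : nat;
  last : option loc;
  next : option loc }.

Definition full (n : node) : bool := item n != None.

Definition memory := loc -> option node.

(* An access to an address that is not allocated fails. *)
Definition modify (m : memory) (x : loc) (f : node -> node) : option memory :=
  let* n := m x in Some (upd m x (Some (f n))).

Definition set_item (m : memory) (x : loc) (o : option I) : option memory :=
  modify m x (fun n => Node o (key n) (rank n) (last n) (next n)).
Definition set_key (m : memory) (x : loc) (k : K) : option memory :=
  modify m x (fun n => Node (item n) k (rank n) (last n) (next n)).
Definition incr_rank (m : memory) (x : loc) : option memory :=
  modify m x (fun n => Node (item n) (key n) (rank n).+1 (last n) (next n)).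
Definition set_last (m : memory) (x : loc) (o : option loc) : option memory :=
  modify m x (fun n => Node (item n) (key n) (rank n) o (next n)).
Definition set_next (m : memory) (x : loc) (o : option loc) : option memory :=
  modify m x (fun n => Node (item n) (key n) (rank n) (last n) o).

Inductive child_of (m : memory) (u : loc) : loc -> Prop :=
| child_last nu v : m u = Some nu -> last nu = Some v -> child_of m u v
| child_next v nv w : child_of m u v -> m v = Some nv -> next nv = Some w ->
    child_of m u w.

Inductive in_tree (m : memory) (r : loc) : loc -> Prop :=
| in_tree_root : in_tree m r r
| in_tree_child u v : in_tree m r u -> child_of m u v -> in_tree m r v.

(* Make [l] the first ([back = false]) or the last ([back = true]) child
   of [w]. *)
Definition attach (back : bool) (m : memory) (w l : loc) : option memory :=
  let* nw := m w in
  match last nw with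
  | None => let* m1 := set_next m l (Some l) in set_last m1 w (Some l)
  | Some z =>
      let* nz := m z in
      let* m1 := set_next m l (next nz) in
      let* m2 := set_next m1 z (Some l) in
      if back then set_last m2 w (Some l) else Some m2
  end.

Definition link_to (ranked : bool) (m : memory) (w l : loc) : option memory :=
  let* m1 := attach (~~ ranked) m w l in
  if ranked then incr_rank m1 w else Some m1.

(* [link ranked m x y w m']: linking [x] and [y] makes [w] the winner. *)
Inductive link (ranked : bool) (m : memory) (x y : loc) : loc -> memory -> Prop :=
| link_left nx ny m' : m x = Some nx -> m y = Some ny ->
    (key nx <= key ny)%O -> link_to ranked m x y = Some m' ->
    link ranked m x y x m'
| link_right nx ny m' : m x = Some nx -> m y = Some ny ->
    (key ny <= key nx)%O -> link_to ranked m y x = Some m' ->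
    link ranked m x y y m'.

Inductive meld_roots (m : memory) :
    option loc -> option loc -> option loc -> memory -> Prop :=
| meld_empty_l r : meld_roots m None r r m
| meld_empty_r r : meld_roots m r None r m
| meld_link x y w m' : link false m x y w m' ->
    meld_roots m (Some x) (Some y) (Some w) m'.

(* Move all but the first two children of [u] to the childless node [v]. *)
Definition move_children (m : memory) (u v : loc) : option memory :=
  let* nu := m u in
  match last nu with
  | None => Some m
  | Some z =>
      let* nz := m z in
      let* a := next nz in
      let* na := m a in
      let* b := next na in
      if (z == a) || (z == b) then Some m else
      let* nb := m b in
      let* m1 := set_next m z (next nb) in
      let* m2 := set_next m1 b (Some a) in
      let* m3 := set_last m2 u (Some b) in
      set_last m3 v (Some z)
  end.

(* Remove the first child of [u] from the non-empty list of children of [u]. *)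
Definition pop_child (m : memory) (u : loc) : option (loc * memory) :=
  let* nu := m u in
  let* z := last nu in
  let* nz := m z in
  let* f := next nz in
  let* m' := (if f == z then set_last m u None
              else let* nf := m f in set_next m z (next nf)) in
  Some (f, m').

(* [heaps st h] is [None] if there is no heap [h], [Some None] if [h] is empty
   and [Some (Some r)] if [h] has root [r].  [array] is the array of roots
   indexed by rank: it is shared by all deletions, each of which resets the
   cells it has used.  [output] is the last result of find-min. *)
Record state := State {
  mem : memory;
  node_of : I -> option loc;
  heaps : handle -> option (option loc);
  array : nat -> option loc;
  output : option I }.

Definition initial : state :=
  State (fun=> None) (fun=> None) (fun=> None) (fun=> None) None.

(* In [Meld h1 h2], the handle [h1] is reused for the resulting heap. *)
Inductive op :=
| MakeHeap of handle
| FindMin of handle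
| Insert of I & K & handle
| DeleteMin of handle
| Meld of handle & handle
| DecreaseKey of I & K & handle
| Delete of I & handle.

Inductive in_heap (st : state) (e : I) (h : handle) (u : loc) : Prop :=
| InHeap r of heaps st h = Some (Some r) & node_of st e = Some u
    & in_tree (mem st) r u.

Definition enabled (st : state) (o : op) : Prop :=
  match o with
  | MakeHeap h => heaps st h = None
  | FindMin h => heaps st h <> None
  | Insert e k h => heaps st h <> None /\ node_of st e = None
  | DeleteMin h => exists r, heaps st h = Some (Some r)
  | Meld h1 h2 => [/\ h1 <> h2, heaps st h1 <> None & heaps st h2 <> None]
  | DecreaseKey e k h => exists u nu,
      [/\ in_heap st e h u, mem st u = Some nu & (k < key nu)%O]
  | Delete e h => exists u, in_heap st e h u
  end.

Definition heap_size (st : state) (h : handle) (N : nat) : Prop :=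
  match heaps st h with
  | Some (Some r) => exists s : seq loc,
      [/\ uniq s, forall x, x \in s <-> in_tree (mem st) r x & size s = N]
  | _ => N = 0
  end.

(* What the machine is doing.  The phases of the deletion of the item in the
   root of [h] are:
   - [Destroying h P F]: the roots are the elements of [P], still to be
     examined, and of [F], known to be full; a hollow root gives up its
     children one at a time and is then destroyed;
   - [RankedLinking h F mr]: the roots are the elements of [F] and those in the
     array, whose indices are at most [mr];
   - [Scanning h i mr G]: the roots in cells [0 .. i-1] of the array have been
     moved to [G];
   - [UnrankedLinking h G]: the roots are the elements of [G]. *)
Inductive control :=
| Idle
| Destroying of handle & seq loc & seq loc
| RankedLinking of handle & seq loc & nat
| Scanning of handle & nat & nat & seq loc
| UnrankedLinking of handle & seq loc.

Definition config := (state * control)%type.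

Inductive delete_item (st : state) (e : I) (h : handle) : config -> Prop :=
| delete_nonroot r u m' :
    heaps st h = Some (Some r) -> node_of st e = Some u -> u <> r ->
    set_item (mem st) u None = Some m' ->
    delete_item st e h
      (State m' (upd (node_of st) e None) (heaps st) (array st) (output st),
       Idle)
| delete_root r m' :
    heaps st h = Some (Some r) -> node_of st e = Some r ->
    set_item (mem st) r None = Some m' ->
    delete_item st e h
      (State m' (upd (node_of st) e None) (heaps st) (array st) (output st),
       Destroying h [:: r] [::]).

Inductive invoke (st : state) : op -> config -> Prop :=
| do_make_heap h :
    invoke st (MakeHeap h)
      (State (mem st) (node_of st) (upd (heaps st) h (Some None)) (array st)
         (output st), Idle)
| do_find_min_empty h :
    heaps st h = Some None ->
    invoke st (FindMin h)
      (State (mem st) (node_of st) (heaps st) (array st) None, Idle)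
| do_find_min h r nr :
    heaps st h = Some (Some r) -> mem st r = Some nr ->
    invoke st (FindMin h)
      (State (mem st) (node_of st) (heaps st) (array st) (item nr), Idle)
| do_insert e k h r x r' m' :
    heaps st h = Some r -> mem st x = None ->
    meld_roots (upd (mem st) x (Some (Node (Some e) k 0 None None)))
      (Some x) r r' m' ->
    invoke st (Insert e k h)
      (State m' (upd (node_of st) e (Some x)) (upd (heaps st) h (Some r'))
         (array st) (output st), Idle)
| do_delete_min h r nr e c :
    heaps st h = Some (Some r) -> mem st r = Some nr -> item nr = Some e ->
    delete_item st e h c ->
    invoke st (DeleteMin h) c
| do_meld h1 h2 r1 r2 r' m' :
    heaps st h1 = Some r1 -> heaps st h2 = Some r2 ->
    meld_roots (mem st) r1 r2 r' m' ->
    invoke st (Meld h1 h2)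
      (State m' (node_of st) (upd (upd (heaps st) h2 None) h1 (Some r'))
         (array st) (output st), Idle)
| do_decrease_key_root e k h r m' :
    heaps st h = Some (Some r) -> node_of st e = Some r ->
    set_key (mem st) r k = Some m' ->
    invoke st (DecreaseKey e k h)
      (State m' (node_of st) (heaps st) (array st) (output st), Idle)
| do_decrease_key e k h r u nu v m1 m2 r' m' :
    heaps st h = Some (Some r) -> node_of st e = Some u -> u <> r ->
    mem st u = Some nu -> mem st v = None ->
    set_item (upd (mem st) v (Some (Node (Some e) k (rank nu - 2) None None)))
      u None = Some m1 ->
    (if 2 < rank nu then move_children m1 u v else Some m1) = Some m2 ->
    meld_roots m2 (Some v) (Some r) r' m' ->
    invoke st (DecreaseKey e k h)
      (State m' (upd (node_of st) e (Some v)) (upd (heaps st) h (Some r'))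
         (array st) (output st), Idle)
| do_delete e h c :
    delete_item st e h c ->
    invoke st (Delete e h) c.

Definition with_mem (st : state) (m : memory) : state :=
  State m (node_of st) (heaps st) (array st) (output st).
Definition with_array (st : state) (a : nat -> option loc) : state :=
  State (mem st) (node_of st) (heaps st) a (output st).
Definition with_root (st : state) (h : handle) (r : option loc) : state :=
  State (mem st) (node_of st) (upd (heaps st) h (Some r)) (array st)
    (output st).

Inductive step (st : state) : control -> config -> Prop :=
| keep_full_root h P F x nx :
    x \in P -> mem st x = Some nx -> full nx ->
    step st (Destroying h P F) (st, Destroying h (rem x P) (x :: F))
| free_child h P F x nx f m' :
    x \in P -> mem st x = Some nx -> ~~ full nx ->
    last nx <> None -> pop_child (mem st) x = Some (f, m') ->
    step st (Destroying h P F) (with_mem st m', Destroying h (f :: P) F)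
| destroy_root h P F x nx :
    x \in P -> mem st x = Some nx -> ~~ full nx -> last nx = None ->
    step st (Destroying h P F)
      (with_mem st (upd (mem st) x None), Destroying h (rem x P) F)
| end_destroying h F :
    step st (Destroying h [::] F) (st, RankedLinking h F 0)
| store_root h F mr x nx :
    x \in F -> mem st x = Some nx -> array st (rank nx) = None ->
    step st (RankedLinking h F mr)
      (with_array st (upd (array st) (rank nx) (Some x)),
       RankedLinking h (rem x F) (maxn mr (rank nx)))
| ranked_link h F mr x nx y w m' :
    x \in F -> mem st x = Some nx -> array st (rank nx) = Some y ->
    link true (mem st) x y w m' ->
    step st (RankedLinking h F mr)
      (with_array (with_mem st m') (upd (array st) (rank nx) None),
       RankedLinking h (w :: rem x F) mr)
| end_ranked_linking h mr :
    step st (RankedLinking h [::] mr) (st, Scanning h 0 mr [::])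
| scan_empty h i mr G :
    i <= mr -> array st i = None ->
    step st (Scanning h i mr G) (st, Scanning h i.+1 mr G)
| scan_root h i mr G x :
    i <= mr -> array st i = Some x ->
    step st (Scanning h i mr G)
      (with_array st (upd (array st) i None), Scanning h i.+1 mr (x :: G))
| end_scanning h i mr G :
    mr < i -> step st (Scanning h i mr G) (st, UnrankedLinking h G)
| unranked_link h G x y w m' :
    x \in G -> y \in G -> x <> y -> link false (mem st) x y w m' ->
    step st (UnrankedLinking h G)
      (with_mem st m', UnrankedLinking h (w :: rem y (rem x G)))
| end_delete_empty h :
    step st (UnrankedLinking h [::]) (with_root st h None, Idle)
| end_delete h x :
    step st (UnrankedLinking h [:: x]) (with_root st h (Some x), Idle).

Definition op_size (st : state) (o : op) (N : nat) : Prop :=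
  match o with
  | Delete _ h | DeleteMin h => heap_size st h N
  | _ => N = 0
  end.

(* [execution l t c]: starting with no heaps, the machine can reach [c] in [t]
   transitions, after the operations listed in [l], the last of which is
   unfinished if [c.2] is not [Idle].  A deletion is listed with the number of
   nodes of its heap when the deletion begins; the number listed with any other
   operation is 0 and plays no role. *)
Inductive execution : seq (op * nat) -> nat -> config -> Prop :=
| exec_init : execution [::] 0 (initial, Idle)
| exec_invoke l t st o N c : execution l t (st, Idle) ->
    enabled st o -> op_size st o N -> invoke st o c ->
    execution (rcons l (o, N)) t.+1 c
| exec_step l t st k c : execution l t (st, k) -> step st k c ->
    execution l t.+1 c.

(* [(trunc_log 2 N).+1] is 1 + floor (log2 N). *)
Definition amortized_bound (C : nat) (p : op * nat) : nat :=
  match p.1 with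
  | Delete _ _ | DeleteMin _ => C * (trunc_log 2 p.2).+1
  | _ => C
  end.

(* The machine is never stuck: together with a bound on the length of all
   executions, this says that every operation terminates. *)
Definition can_proceed (c : config) : Prop :=
  match c.2 with
  | Idle => forall o, enabled c.1 o ->
      exists N c', op_size c.1 o N /\ invoke c.1 o c'
  | k => exists c', step c.1 k c'
  end.

End HollowHeap.

Arguments node {disp} K I.
Arguments memory {disp} K I.
Arguments state {disp} K I.
Arguments op {disp} K I.
Arguments config {disp} K I.

(* Main.v *)
Require Import Defs.
From mathcomp Require Import all_boot all_order.
From mathcomp Require Import zify.
From Stdlib Require Import Classical.

Set Implicit Arguments.
Unset Strict Implicit.
Unset Printing Implicit Defensive.

(* Amortization.  A child that is not a ranked child of a full node holds 4
   credits; they pay for its detachment, its destruction or placement among the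
   full roots, its storage in the array, and a ranked link.  The winner of a
   ranked link gains both a child and a unit of rank, so such a link creates no
   new holder of credits, and a node that becomes hollow creates at most as many
   as it has ranked children: at most 2 after a decrease-key, and at most
   O(log N) in a deletion.  For the latter, a non-root or full node of rank r
   has children of ranks r - 1 and r - 2 (if r > 1), hence at least 2^(r/2)
   descendants.  The scan of the array and the unranked links that end a
   deletion also cost O(log N), since distinct roots then have distinct ranks.

   The memory is described by ghost data: [kids g u] is the list of the children
   of [u], [par g x] is the parent of [x] or, if [x] is a root, the heap it
   belongs to, and [ht g] decreases from parent to child, which excludes cycles.
   Since only the winner of a link, a root, has its [ht] raised, linking needs no
   update in the subtrees. *)

(** * Circular lists as sequences with the cyclic successor [next] *)

Section CyclicSuccessor.
Variable T : eqType.
Implicit Types (x y z l : T) (c : seq T).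

Definition olast c : option T := if c is y :: c' then Some (last y c') else None.

Lemma olast_rcons c x : olast (rcons c x) = Some x.
Proof. by case: c => [|y c] //=; rewrite last_rcons. Qed.

Lemma olast_mem c x : olast c = Some x -> x \in c.
Proof. by case: c => //= y c [<-]; apply: mem_last. Qed.

Lemma next_at_last y0 y c :
  uniq (y :: c) -> next_at (last y c) y0 y c = y0.
Proof.
elim: c y => [|z c IH] y /=; first by rewrite eqxx.
case/andP=> yzc /IH ->; case: eqP => // e.
by move: yzc; rewrite -e mem_last.
Qed.

(** The start [y0] is returned only at the last element, where the cycle closes; elsewhere it can be
    replaced. *)
Lemma next_at_start y0 y1 y c x :
  x \in y :: c -> x != last y c -> next_at x y0 y c = next_at x y1 y c.
Proof.
elim: c y => [|z c IH] y /=; first by rewrite inE => ->.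
rewrite inE; case: eqP => //= _; exact: IH.
Qed.

Lemma next_last z c : uniq c -> olast c = Some z -> next c z = head z c.
Proof. by case: c => //= y c u [<-]; apply: next_at_last. Qed.

Lemma next_consl l c : next (l :: c) l = head l c.
Proof. by case: c => [|y c] /=; rewrite eqxx. Qed.

Lemma next_cons_last l z c :
  uniq (l :: c) -> olast c = Some z -> next (l :: c) z = l.
Proof.
by case: c => //= y c /andP [lc u] [<-]; rewrite ifN ?next_at_last //;
  apply: contra lc => /eqP <-; apply: mem_last.
Qed.

Lemma next_cons l c x :
  uniq (l :: c) -> x \in c -> olast c != Some x -> next (l :: c) x = next c x.
Proof.
case: c => //= y c /andP [lc u] xc nl; rewrite ifN; last first.
  by apply: contra lc => /eqP <-.
by apply: next_at_start => //; apply: contra nl => /eqP ->.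
Qed.

(** Insertion at the back and insertion at the front give the same cycle up to rotation. Ranked and
    unranked links thus differ only in the pointer to the last child. *)
Lemma next_rcons c l x : uniq (l :: c) -> next (rcons c l) x = next (l :: c) x.
Proof. by move=> u; rewrite -rot1_cons next_rot. Qed.

Lemma next_nthS c z i :
  uniq c -> i.+1 < size c -> next c (nth z c i) = nth z c i.+1.
Proof.
move=> uc ic; rewrite next_nth mem_nth ?index_uniq //; try exact: ltnW.
by case: c uc ic => //= y p _ ip; apply: set_nth_default.
Qed.

End CyclicSuccessor.

(** * The memory seen field by field, and the effect of single writes *)

Lemma updE (A : eqType) B (f : A -> B) a b x :
  upd f a b x = if x == a then b else f x.
Proof. by []. Qed.

Section Fields.
Context {disp : Order.disp_t} {K : orderType disp} {I : eqType}.
Implicit Types (m : memory K I) (x y z u v w l : loc).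

Definition alloc m x : bool := if m x is Some _ then true else false.
(** Total projections of the partial memory: a free address reads as a hollow childless node of rank
    0. *)
Definition itm m x : option I := if m x is Some n then item n else None.
Definition rk m x : nat := if m x is Some n then rank n else 0.
Definition la m x : option loc := if m x is Some n then Defs.last n else None.
Definition ne m x : option loc := if m x is Some n then Defs.next n else None.

Lemma allocP m x : alloc m x -> exists n, m x = Some n.
Proof. by rewrite /alloc; case: (m x) => // n _; exists n. Qed.

(** Writes are described up to pointwise equality of the fields, so that successive writes compose
    by rewriting, without unfolding the memory. *)
Record same_fields m m' (i : loc -> option I) (r : loc -> nat)
    (a b : loc -> option loc) : Prop := SameFields {
  sf_alloc : alloc m' =1 alloc m;
  sf_itm : itm m' =1 i;
  sf_rk : rk m' =1 r;
  sf_la : la m' =1 a;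
  sf_ne : ne m' =1 b }.

Ltac fields_of_modify :=
  let E := fresh "E" in let e := fresh "e" in
  case/allocP=> ? E; rewrite /modify E /=; eexists; first (by []); split=> ?;
  rewrite /alloc /itm /rk /la /ne !updE; by case: eqP => // e; rewrite ?e E.

Lemma set_nextP m x o : alloc m x -> exists2 m', set_next m x o = Some m' &
  same_fields m m' (itm m) (rk m) (la m) (upd (ne m) x o).
Proof. by rewrite /set_next; fields_of_modify. Qed.

Lemma set_lastP m x o : alloc m x -> exists2 m', set_last m x o = Some m' &
  same_fields m m' (itm m) (rk m) (upd (la m) x o) (ne m).
Proof. by rewrite /set_last; fields_of_modify. Qed.

Lemma set_itemP m x o : alloc m x -> exists2 m', set_item m x o = Some m' &
  same_fields m m' (upd (itm m) x o) (rk m) (la m) (ne m).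
Proof. by rewrite /set_item; fields_of_modify. Qed.

Lemma set_keyP m x k : alloc m x -> exists2 m', set_key m x k = Some m' &
  same_fields m m' (itm m) (rk m) (la m) (ne m).
Proof. by rewrite /set_key; fields_of_modify. Qed.

Lemma incr_rankP m x : alloc m x -> exists2 m', incr_rank m x = Some m' &
  same_fields m m' (itm m) (upd (rk m) x (rk m x).+1) (la m) (ne m).
Proof. by rewrite /incr_rank; fields_of_modify. Qed.

End Fields.

(** * Ghost forests and the pointer structures that represent them *)

Record ghost := Ghost {
  dom : seq loc;
  kids : loc -> seq loc;
  par : loc -> loc + handle;
  ht : loc -> nat }.

Section Shape.
Context {disp : Order.disp_t} {K : orderType disp} {I : eqType}.
Implicit Types (m : memory K I) (x y z u v w l : loc) (g : ghost).

(** By [sh_par] the child lists are disjoint and agree with [par]; [sh_last] and [sh_next] tie them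
    to the pointers. The field [next] of a root is left unconstrained. *)
Record shape m g : Prop := Shape {
  sh_uniq : uniq (dom g);
  sh_dom : forall x, (x \in dom g) = alloc m x;
  sh_kids : forall u, uniq (kids g u);
  sh_par : forall u x, (x \in kids g u) = (par g x == inl u);
  sh_alloc : forall u x, x \in kids g u -> (u \in dom g) && (x \in dom g);
  sh_ht : forall u x, x \in kids g u -> ht g x < ht g u;
  sh_last : forall u, la m u = olast (kids g u);
  sh_next : forall u x, x \in kids g u -> ne m x = Some (next (kids g u) x) }.

(** The new height of [w] exceeds its old one and that of [l], hence those of all its children. *)
Definition add_kid (back : bool) g w l : ghost :=
  Ghost (dom g)
    (upd (kids g) w (if back then rcons (kids g w) l else l :: kids g w))
    (upd (par g) l (inl w)) (upd (ht g) w (ht g w + ht g l).+1).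

Lemma root_kid m g x h u : shape m g -> par g x = inr h -> x \in kids g u = false.
Proof. by move=> sh px; rewrite (sh_par sh) px. Qed.

Lemma attachP (back : bool) m g w l a b :
  shape m g -> w != l -> alloc m w -> alloc m l ->
  par g w = inr a -> par g l = inr b ->
  exists2 m', attach back m w l = Some m' &
    [/\ shape m' (add_kid back g w l), itm m' =1 itm m & rk m' =1 rk m].
Proof.
move=> sh wl aw al pw pl.
have lk u : l \in kids g u = false by apply: (root_kid u sh pl).
have wk u : w \in kids g u = false by apply: (root_kid u sh pw).
pose c := if back then rcons (kids g w) l else l :: kids g w.
have cE x : x \in c = (x == l) || (x \in kids g w).
  by rewrite /c; case: (back); rewrite ?mem_rcons inE.
have uc : uniq (l :: kids g w) by rewrite /= lk (sh_kids sh).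
have nc x : next c x = next (l :: kids g w) x.
  by rewrite /c; case: (back); rewrite ?next_rcons.
(* What remains is a pointer computation: [next] changes only at [l] and at the former last child of
   [w]. Both positions of [l] yield the same cycle, so only [last] depends on [back]. *)
suff [m' e [e1 e2 e3 e4 e5]] : exists2 m', attach back m w l = Some m' &
    [/\ alloc m' =1 alloc m, itm m' =1 itm m, rk m' =1 rk m,
      la m' =1 upd (la m) w (olast c) &
      forall u x, x \in kids g u \/ x = l ->
       ne m' x = if x == l then Some (next c l) else
                 if olast (kids g w) == Some x then Some l else ne m x].
  exists m' => //; split=> //; split=> /=.
  - exact: sh_uniq sh.
  - by move=> x; rewrite e1 (sh_dom sh).
  - move=> u; rewrite updE; case: eqP => _; last exact: sh_kids sh u.
    by rewrite -/c /c; case: (back); rewrite ?rcons_uniq.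
  - move=> u x; rewrite !updE -/c; case: (eqVneq u w) => [->|uw].
      by rewrite cE; case: (eqVneq x l) => [->|_] /=;
        [rewrite eqxx|rewrite (sh_par sh)].
    case: (eqVneq x l) => [->|_]; last exact: sh_par sh u x.
    rewrite lk; symmetry; apply/eqP => -[] e6; by rewrite e6 eqxx in uw.
  - move=> u x; rewrite !updE -/c; case: (eqVneq u w) => [->|uw];
      last exact: sh_alloc sh u x.
    rewrite cE; case/orP => [/eqP ->|]; last exact: sh_alloc sh w x.
    by rewrite !(sh_dom sh) aw al.
  - move=> u x; rewrite !updE -/c; case: (eqVneq u w) => [_|uw].
      rewrite cE; case: (eqVneq x w) => [->|xw]; first by rewrite (negPf wl) wk.
      by case/orP => [/eqP ->|/(sh_ht sh)]; lia.
    by case: (eqVneq x w) => [->|xw]; [rewrite wk|apply: sh_ht sh u x].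
  - by move=> u; rewrite e4 !updE -/c; case: eqP => // _; apply: sh_last sh u.
  - move=> u x; rewrite !updE -/c; case: (eqVneq u w) => [_|uw].
      rewrite cE => H; rewrite (e5 w); last by case/orP: H => [/eqP ->|->]; auto.
      case/orP: H => [/eqP ->|xw]; first by rewrite eqxx.
      case: (eqVneq x l) => [->//|xl]; rewrite nc; case: eqP => [ol|/eqP nol].
        by rewrite (next_cons_last uc ol).
      by rewrite (next_cons uc xw nol) (sh_next sh xw).
    move=> xu; rewrite (e5 u); last by left.
    case: (eqVneq x l) => [xl|_]; first by rewrite xl lk in xu.
    rewrite ifN ?(sh_next sh xu) //; apply/eqP => /olast_mem.
    by move: xu; rewrite !(sh_par sh) => /eqP -> /eqP [e6]; rewrite e6 eqxx in uw.
have [n mw] := allocP aw.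
have lw : Defs.last n = olast (kids g w) by rewrite -(sh_last sh) /la mw.
rewrite /attach mw /= lw nc next_consl.
have [oN|oN] := boolP (isSome (olast (kids g w))); last first.
  have kw : kids g w = [::] by case: (kids g w) oN.
  rewrite kw /=.
  have [m1 -> s1] := set_nextP (Some l) al.
  have aw1 : alloc m1 w by rewrite (sf_alloc s1).
  have [m2 e2 s2] := set_lastP (Some l) aw1.
  exists m2; first by rewrite /= e2.
  case: s1 => a1 i1 r1 l1 n1; case: s2 => a2 i2 r2 l2 n2; split=> x.
  - by rewrite a2 a1.
  - by rewrite i2 i1.
  - by rewrite r2 r1.
  - by rewrite l2 !updE l1 /c kw; case: (back).
  - by move=> y _; rewrite n2 n1 updE.
case oz: (olast (kids g w)) oN => [z|] // _ /=.
have zw := olast_mem oz.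
have /andP [_ az] := sh_alloc sh zw; rewrite (sh_dom sh) in az.
have zl : z != l by apply: contraTneq zw => ->; rewrite lk.
have [nz mz] := allocP az; rewrite mz /=.
have -> : Defs.next nz = Some (head l (kids g w)).
  have := sh_next sh zw; rewrite /ne mz (next_last (sh_kids sh w) oz) => ->.
  by case: (kids g w) oz.
have [m1 -> s1] := set_nextP (Some (head l (kids g w))) al.
have az1 : alloc m1 z by rewrite (sf_alloc s1).
have [m2 /= -> s2] := set_nextP (Some l) az1.
have n2E u x : x \in kids g u \/ x = l ->
    ne m2 x = if x == l then Some (head l (kids g w)) else
              if Some z == Some x then Some l else ne m x.
  move=> _; rewrite (sf_ne s2) updE (sf_ne s1) updE.
  case: (eqVneq x l) => [->|xl]; first by rewrite eq_sym (negPf zl).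
  by rewrite eq_sym.
case: s1 => a1 i1 r1 l1 n1; case: s2 => a2 i2 r2 l2 n2.
have aw2 : alloc m2 w by rewrite a2 a1.
rewrite /c; case: (back).
  have [m3 /= -> [a3 i3 r3 l3 n3]] := set_lastP (Some l) aw2.
  exists m3 => //; split=> // x.
  - by rewrite a3 a2 a1.
  - by rewrite i3 i2 i1.
  - by rewrite r3 r2 r1.
  - by rewrite l3 !updE l2 l1 olast_rcons.
  - by move=> y H; rewrite n3; apply: n2E H.
exists m2 => //; split=> // x.
- by rewrite a2 a1.
- by rewrite i2 i1.
- by rewrite r2 r1.
- rewrite l2 l1 updE; case: eqP => // ->.
  by rewrite (sh_last sh) oz; case: (kids g w) oz => //= y p [->].
Qed.

Lemma shape_ext m m' g : alloc m' =1 alloc m -> la m' =1 la m ->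
  ne m' =1 ne m -> shape m g -> shape m' g.
Proof.
move=> e1 e2 e3 [s1 s2 s3 s4 s5 s6 s7 s8]; split=> // [x|u|u x].
- by rewrite e1.
- by rewrite e2.
- by rewrite e3; apply: s8.
Qed.

(** The heap label of a root does not enter into [shape]; only the [inl] entries of [par] do. *)
Lemma shape_par m g p : (forall x u, (p x == inl u) = (par g x == inl u)) ->
  shape m g -> shape m (Ghost (dom g) (kids g) p (ht g)).
Proof. by move=> e [*]; split=> //= u x; rewrite e. Qed.

(* [n] exceeds the heights of the children that [x] is about to receive. *)
Definition add_node g x h n : ghost :=
  Ghost (x :: dom g) (kids g) (upd (par g) x (inr h)) (upd (ht g) x n).

(** A free address lies outside [dom], so by [sh_alloc] it has no children and is in no child
    list. *)
Lemma shape_add_node m g x h n (e : option I) k r : shape m g -> m x = None ->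
  shape (upd m x (Some (Node e k r None None))) (add_node g x h n) /\
  kids g x = [::].
Proof.
move=> sh mx; have xd : x \notin dom g by rewrite (sh_dom sh) /alloc mx.
have kx : kids g x = [::].
  case E: (kids g x) => [//|y c]; have := sh_alloc sh (u := x) (x := y).
  by rewrite E mem_head (negPf xd) => /(_ isT).
have xk u : x \in kids g u = false.
  by apply: contraNF xd => /(sh_alloc sh) /andP [].
split=> //; split=> /=.
- by rewrite xd (sh_uniq sh).
- move=> y; rewrite inE (sh_dom sh) /alloc updE; by case: eqP.
- exact: sh_kids sh.
- by move=> u y; rewrite updE; case: (eqVneq y x) => [->|_];
    [rewrite xk|exact: sh_par sh u y].
- by move=> u y /(sh_alloc sh); rewrite !inE => /andP [-> ->]; rewrite !orbT.
- move=> u y yu; rewrite !updE; case: (eqVneq u x) yu => [->|_] yu.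
    by rewrite kx in yu.
  by case: (eqVneq y x) yu => [->|_]; [rewrite xk|apply: sh_ht sh u y].
- move=> u; rewrite /la updE; case: eqP => [->|_]; first by rewrite kx.
  exact: sh_last sh u.
- move=> u y yu; rewrite /ne updE; case: eqP => [e1|_]; first by rewrite e1 xk in yu.
  exact: sh_next sh u y yu.
Qed.

Definition free_kid g u h : ghost :=
  if kids g u is f :: c then
    Ghost (dom g) (upd (kids g) u c) (upd (par g) f (inr h)) (ht g)
  else g.

Lemma pop_childP m g u h f c : shape m g -> kids g u = f :: c ->
  exists2 m', pop_child m u = Some (f, m') &
    [/\ shape m' (free_kid g u h), itm m' =1 itm m & rk m' =1 rk m].
Proof.
move=> sh ku.
have mk y : y \in f :: c -> par g y = inl u.
  by rewrite -ku (sh_par sh) => /eqP.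
have uk := sh_kids sh u; rewrite ku in uk.
have [fc uc] : f \notin c /\ uniq c by apply/andP; rewrite -cons_uniq.
have kf : f \in kids g u by rewrite ku mem_head.
have /andP [au af] := sh_alloc sh kf; rewrite !(sh_dom sh) in au af.
have [nu mu] := allocP au; have [nf mf] := allocP af.
have oz : olast (kids g u) = Some (last f c) by rewrite ku.
have zu := olast_mem oz; set z := last f c in oz zu *.
have lu : Defs.last nu = Some z.
  by move: (sh_last sh u); rewrite oz /la mu.
have /andP [_ az] := sh_alloc sh zu; rewrite (sh_dom sh) in az.
have [nz mz] := allocP az.
have nzE : Defs.next nz = Some f.
  by have := sh_next sh zu; rewrite /ne mz (next_last (sh_kids sh u) oz) ku.
(* Again only pointers matter: if children remain, the last one inherits the [next] field of the
   removed first child [f]. *)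
suff [m' e [e1 e2 e3 e4 e5]] : exists2 m', pop_child m u = Some (f, m') &
    [/\ alloc m' =1 alloc m, itm m' =1 itm m, rk m' =1 rk m,
      la m' =1 upd (la m) u (olast c) &
      forall v x, x \in kids g v -> x != f ->
       ne m' x = if olast c == Some x then ne m f else ne m x].
  exists m' => //; split=> //; rewrite /free_kid ku; split=> /=.
  - exact: sh_uniq sh.
  - by move=> x; rewrite e1 (sh_dom sh).
  - by move=> v; rewrite updE; case: eqP => _ //; apply: sh_kids sh v.
  - move=> v x; rewrite !updE; case: (eqVneq v u) => [->|vu].
      case: (eqVneq x f) => [->|xf]; first by rewrite (negPf fc).
      by rewrite -(sh_par sh) ku inE (negPf xf).
    case: (eqVneq x f) => [->|xf]; last exact: sh_par sh v x.
    rewrite (sh_par sh) mk ?mem_head //; apply/eqP => -[e6].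
    by rewrite e6 eqxx in vu.
  - move=> v x; rewrite updE; case: eqP => [->|_] H; apply: (sh_alloc sh) => //.
    by rewrite ku inE H orbT.
  - move=> v x; rewrite updE; case: eqP => [->|_] H; apply: (sh_ht sh) => //.
    by rewrite ku inE H orbT.
  - by move=> v; rewrite e4 !updE; case: eqP => // _; apply: sh_last sh v.
  - move=> v x; rewrite !updE; case: (eqVneq v u) => [_|vu] H.
      have xf : x != f by apply: contraTneq H => ->.
      have xu : x \in kids g u by rewrite ku inE H orbT.
      rewrite (e5 u) //; case: eqP => [ol|/eqP nol].
        rewrite (sh_next sh kf) ku next_consl (next_last uc ol).
        by case: (c) H.
      by rewrite (sh_next sh xu) ku (next_cons uk H nol).
    have pv : par g x = inl v by apply/eqP; rewrite -(sh_par sh).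
    have nxu : x \notin f :: c.
      by apply: contra vu => /mk; rewrite pv => -[->].
    rewrite (e5 v) //; last by apply: contra nxu => /eqP ->; rewrite mem_head.
    rewrite ifN ?(sh_next sh H) //; apply: contra nxu => /eqP /olast_mem.
    by rewrite inE orbC => ->.
rewrite /pop_child mu /= lu /= mz /= nzE /=.
have [fz|fz] := eqVneq f z.
  have [m' -> s1] := set_lastP None au.
  exists m' => //; case: s1 => a1 i1 r1 l1 n1.
  have c0 : c = [::].
    move: fc; rewrite {}fz /z; case: (c) => // y p.
    by rewrite /= mem_last.
  by rewrite c0; split=> // v x xv xf; rewrite n1.
rewrite mf /=.
have [m' -> s1] := set_nextP (Defs.next nf) az.
exists m' => //; case: s1 => a1 i1 r1 l1 n1.
have oc : olast c = Some z by move: fz; rewrite /z; case: (c) => //=; rewrite eqxx.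
split=> // [x|v x xv xf].
  rewrite l1 updE; case: eqP => // ->; by rewrite (sh_last sh) oz oc.
by rewrite n1 updE oc {2}/ne mf eq_sym.
Qed.

Definition remove_node g x : ghost :=
  Ghost (rem x (dom g)) (kids g) (par g) (ht g).

Lemma shape_remove_node m g x h : shape m g -> par g x = inr h ->
  kids g x = [::] -> shape (upd m x None) (remove_node g x).
Proof.
move=> sh px kx; have xk u := root_kid u sh px.
split=> /=.
- by rewrite rem_uniq ?(sh_uniq sh).
- move=> y; rewrite mem_rem_uniq ?(sh_uniq sh) // inE (sh_dom sh) /alloc updE.
  by case: eqP.
- exact: sh_kids sh.
- exact: sh_par sh.
- move=> u y yu; rewrite !mem_rem_uniq ?(sh_uniq sh) // !inE.
  have /andP [-> ->] := sh_alloc sh yu; rewrite !andbT.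
  apply/andP; split; first by apply: contraTneq yu => ->; rewrite kx.
  by apply: contraTneq yu => ->; rewrite xk.
- exact: sh_ht sh.
- move=> u; rewrite /la updE; case: eqP => [->|_]; first by rewrite kx.
  exact: sh_last sh u.
- move=> u y yu; rewrite /ne updE; case: eqP => [e1|_]; first by rewrite e1 xk in yu.
  exact: sh_next sh u y yu.
Qed.

Definition move_kids g u v : ghost :=
  Ghost (dom g)
    (upd (upd (kids g) u (take 2 (kids g u))) v (drop 2 (kids g u)))
    (fun x => if x \in drop 2 (kids g u) then inl v else par g x) (ht g).

(** The circle is cut into two: the second child is redirected to the first, and the last child to
    the third. The hypothesis on heights places the moved children below [v]. *)
Lemma move_childrenP m g u v : shape m g -> 2 < size (kids g u) -> u != v ->
  alloc m v -> kids g v = [::] -> ht g u <= ht g v ->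
  exists2 m', move_children m u v = Some m' &
    [/\ shape m' (move_kids g u v), itm m' =1 itm m & rk m' =1 rk m].
Proof.
move=> sh sk uv av kv huv; case ku: (kids g u) sk => [//|a [//|b [//|d c]]] _.
have mk y : y \in [:: a, b, d & c] -> par g y = inl u.
  by rewrite -ku (sh_par sh) => /eqP.
have uk := sh_kids sh u; rewrite ku in uk.
have := uk; rewrite !(cons_uniq _ (_ :: _)) => /and3P [ac bc uk2].
pose z := last d c.
have sub x : x \in d :: c -> x \in kids g u.
  by rewrite ku !inE => /orP [] ->; rewrite !orbT.
have ka : a \in kids g u by rewrite ku mem_head.
have kb : b \in kids g u by rewrite ku !inE eqxx orbT.
have oz : olast (kids g u) = Some z by rewrite ku.
have zu := olast_mem oz.
have zdc : z \in d :: c by apply: mem_last.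
have /andP [au aa] := sh_alloc sh ka; rewrite !(sh_dom sh) in au aa.
have /andP [_ ab] := sh_alloc sh kb; rewrite !(sh_dom sh) in ab.
have /andP [_ az] := sh_alloc sh zu; rewrite !(sh_dom sh) in az.
have [nu mu] := allocP au; have [na ma] := allocP aa.
have [nb mb] := allocP ab; have [nz mz] := allocP az.
have lu : Defs.last nu = Some z.
  by move: (sh_last sh u); rewrite oz /la mu.
have nzE : Defs.next nz = Some a.
  by have := sh_next sh zu; rewrite /ne mz (next_last (sh_kids sh u) oz) ku.
have naE : Defs.next na = Some b.
  by have := sh_next sh ka; rewrite /ne ma ku next_consl.
have nbE : Defs.next nb = Some d.
  have := sh_next sh kb; rewrite /ne mb ku next_cons ?inE ?eqxx ?orbT //.
    by rewrite next_consl.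
  by apply: contra bc => /= /eqP [<-].
(* There are at least three distinct children, so the last is neither of the first two and the early
   exit of [move_children] is excluded. *)
have za : z != a by apply: contraNneq ac => <-; rewrite inE zdc orbT.
have zb : z != b by apply: contraNneq bc => <-.
rewrite /move_children mu /= lu /= mz /= nzE /= ma /= naE /= (negPf za) (negPf zb) /=.
rewrite mb /= nbE.
have [m1 -> [a1 i1 r1 l1 n1]] := set_nextP (Some d) az.
have ab1 : alloc m1 b by rewrite a1.
have [m2 /= -> [a2 i2 r2 l2 n2]] := set_nextP (Some a) ab1.
have au2 : alloc m2 u by rewrite a2 a1.
have [m3 /= -> [a3 i3 r3 l3 n3]] := set_lastP (Some b) au2.
have av3 : alloc m3 v by rewrite a3 a2 a1.
have [m4 /= -> [a4 i4 r4 l4 n4]] := set_lastP (Some z) av3.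
exists m4 => //; split; last 2 first.
- by move=> x; rewrite i4 i3 i2 i1.
- by move=> x; rewrite r4 r3 r2 r1.
rewrite /move_kids ku /=; split=> /=.
- exact: sh_uniq sh.
- by move=> x; rewrite a4 a3 a2 a1 (sh_dom sh).
- move=> w; rewrite !updE; case: eqP => _ //; case: eqP => _; last exact: sh_kids sh w.
  by move: ac; rewrite /= !inE andbT; apply: contra => ->.
- move=> w x; rewrite !updE; case: (boolP (x \in d :: c)) => xdc.
    have -> : (inl v == inl w :> loc + handle) = (w == v).
      by rewrite eq_sym; apply/eqP/eqP => [[]|->].
    case: (eqVneq w v) => [//|wv]; case: (eqVneq w u) => [_|wu].
      rewrite !inE; case: (eqVneq x a) xdc => [->|_] xdc /=.
        by move: ac; rewrite inE xdc orbT.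
      by case: (eqVneq x b) xdc => [->|//] xdc; rewrite xdc in bc.
    rewrite (sh_par sh) (mk x) ?inE; last by rewrite inE in xdc; rewrite xdc !orbT.
    by apply/eqP => -[e]; rewrite e eqxx in wu.
  rewrite -(sh_par sh); case: (eqVneq w v) => [->|wv]; first by rewrite kv (negPf xdc).
  case: (eqVneq w u) => [->|//].
  by rewrite ku [in RHS]inE [in RHS]inE (negPf xdc) orbF !inE.
- move=> w x; rewrite !updE; case: (eqVneq w v) => [->|wv] H.
    by have /andP [_ ->] := sh_alloc sh (sub x H); rewrite (sh_dom sh) av.
  case: (eqVneq w u) H => [->|_] H; apply: (sh_alloc sh) => //.
  by move: H; rewrite ku !inE => /orP [] ->; rewrite ?orbT.
- move=> w x; rewrite !updE; case: (eqVneq w v) => [->|wv] H.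
    exact: leq_trans (sh_ht sh (sub x H)) huv.
  case: (eqVneq w u) H => [->|_] H; apply: (sh_ht sh) => //.
  by move: H; rewrite ku !inE => /orP [] ->; rewrite ?orbT.
- move=> w; rewrite l4 !updE; case: eqP => _ //; rewrite l3 !updE; case: eqP => _ //.
  by rewrite l2 l1 (sh_last sh).
- move=> w x; rewrite !updE n4 n3 n2 updE n1 updE.
  case: (eqVneq w v) => [_|wv] H.
    rewrite ifN; last by apply: contraNneq bc => <-.
    case: (eqVneq x z) => [->|xz]; first by rewrite (next_last uk2).
    have nol : Some z != Some x by apply: contra xz => /eqP [->].
    have uk1 : uniq [:: b, d & c] by rewrite cons_uniq bc.
    have H1 : x \in [:: b, d & c] by rewrite inE H orbT.
    by rewrite (sh_next sh (sub _ H)) ku (next_cons uk H1 nol) (next_cons uk1 H nol).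
  case: (eqVneq w u) H => [_|wu] H.
    move: H; rewrite !inE; case: (eqVneq x b) => [->|xb].
      rewrite orbT => _; rewrite /= eqxx ifN //.
      by apply: contraNneq ac => <-; rewrite inE eqxx.
    rewrite orbF => /eqP ->; rewrite /= eqxx ifN 1?eq_sym //.
    by rewrite (sh_next sh ka) ku next_consl.
  have pw : par g x = inl w by apply/eqP; rewrite -(sh_par sh).
  have nxu y : y \in kids g u -> x != y.
    apply: contraTneq => <-; rewrite (sh_par sh) pw.
    by apply: contra wu => /eqP [->].
  by rewrite !ifN ?nxu // (sh_next sh H).
Qed.

End Shape.

(** Two sums that differ in one term, compared without subtraction. It reduces a change of [phi] to
    the change of [charge] at one node. *)
Lemma sum_but1 (T : eqType) (F G : T -> nat) (s : seq T) u :
  uniq s -> u \in s -> (forall x, x \in s -> x != u -> F x = G x) ->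
  \sum_(x <- s) F x + G u = \sum_(x <- s) G x + F u.
Proof.
move=> us su e; rewrite (big_rem u su) [in RHS](big_rem u su) /=.
rewrite (eq_big_seq G); first by lia.
by move=> x; rewrite mem_rem_uniq // inE => /andP [xu xs]; apply: e.
Qed.

(** * Ranks of children, and the effect of each structural change on [phi] *)

Section Forest.
Context {disp : Order.disp_t} {K : orderType disp} {I : eqType}.
Implicit Types (m : memory K I) (x y z u v w l : loc) (g : ghost).

Definition full_at m x : bool := isSome (itm m x).
Definition is_kid g x : bool := if par g x is inl _ then true else false.
(** The length of the guaranteed prefix of ranked children: all of them at a full node, and at a
    hollow one only the two of highest rank, which a decrease-key leaves behind. *)
Definition nranked m u := if full_at m u then rk m u else minn 2 (rk m u).

(* Hollow roots are excluded: they lose their children one at a time. *)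
Definition ranks m g := forall u i,
  full_at m u || is_kid g u -> i < nranked m u ->
  i < size (kids g u) /\ rk m (nth 0 (kids g u) i) = rk m u - i.+1.

Definition forest m g := shape m g /\ ranks m g.

(* The number of children of [u] that are not ranked children of a full node. *)
Definition charge m g u := size (kids g u) - (if full_at m u then rk m u else 0).
Definition phi m g := \sum_(u <- dom g) charge m g u.

Lemma full_alloc m x : full_at m x -> alloc m x.
Proof. by rewrite /full_at /itm /alloc; case: (m x). Qed.

Lemma full_eq m m' x : itm m' x = itm m x -> full_at m' x = full_at m x.
Proof. by rewrite /full_at => ->. Qed.

(** At a full node the subtraction in [charge] is therefore never truncated. *)
Lemma full_size m g u : ranks m g -> full_at m u -> rk m u <= size (kids g u).
Proof.
move=> rg fu; case e: (rk m u) => [//|r].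
by have [] := rg u r; rewrite ?fu // /nranked fu e.
Qed.

Lemma forest_ext m m' g : alloc m' =1 alloc m -> itm m' =1 itm m ->
  rk m' =1 rk m -> la m' =1 la m -> ne m' =1 ne m ->
  forest m g -> forest m' g /\ phi m' g = phi m g.
Proof.
move=> ea ei er el en [sh rg]; have ef u := full_eq (ei u).
split; [split; first exact: shape_ext sh|].
  by move=> u i; rewrite /nranked !er ef; apply: rg.
by apply: eq_bigr => u _; rewrite /charge ef er.
Qed.

Definition retag g w h : ghost :=
  Ghost (dom g) (kids g) (upd (par g) w (inr h)) (ht g).

Lemma forest_retag m g w a h : par g w = inr a -> forest m g ->
  forest m (retag g w h) /\ phi m (retag g w h) = phi m g.
Proof.
move=> pw [sh rg]; split=> //; split.
  by apply: shape_par sh => x u; rewrite updE; case: (eqVneq x w) => // ->; rewrite pw.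
move=> u i; rewrite /is_kid /= updE; case: eqP => [->|_]; last exact: rg.
by rewrite orbF => fw; apply: rg; rewrite fw.
Qed.

(** A ranked link puts the loser at index 0, one rank below the winner's new rank, and shifts the
    old children by one, as [ranks] demands; rank and number of children grow together, so [charge]
    is unchanged. An unranked link appends beyond the constrained prefix and adds one to
    [charge]. *)
Lemma link_toP (ranked : bool) m g w l a b : forest m g -> w != l ->
  par g w = inr a -> par g l = inr b -> full_at m w -> full_at m l ->
  (ranked -> rk m w = rk m l) ->
  exists2 m', link_to ranked m w l = Some m' &
    [/\ forest m' (add_kid (~~ ranked) g w l), itm m' =1 itm m,
        rk m' =1 (if ranked then upd (rk m) w (rk m w).+1 else rk m) &
        phi m' (add_kid (~~ ranked) g w l) = phi m g + ~~ ranked].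
Proof.
move=> [sh rg] wl pw pl fw fl rwl.
have [m1 e1 [sh1 i1 r1]] :=
  attachP (~~ ranked) sh wl (full_alloc fw) (full_alloc fl) pw pl.
have [m' e' [sh' i' r']] : exists2 m', link_to ranked m w l = Some m' &
    [/\ shape m' (add_kid (~~ ranked) g w l), itm m' =1 itm m &
        rk m' =1 (if ranked then upd (rk m) w (rk m w).+1 else rk m)].
  rewrite /link_to e1 /=; case: (ranked) sh1 e1 => sh1 e1; last by exists m1.
  have aw1 : alloc m1 w by rewrite -(sh_dom sh1) /= (sh_dom sh) full_alloc.
  have [m2 -> [a2 i2 r2 l2 n2]] := incr_rankP aw1.
  exists m2 => //; split=> [|x|x]; first exact: shape_ext sh1.
    by rewrite i2 i1.
  by rewrite r2 !updE !r1.
have ef u := full_eq (i' u).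
have rE u : u != w -> rk m' u = rk m u.
  by rewrite r'; case: ranked {rwl e1 sh1 e' sh' r'} => // uw; rewrite updE (negPf uw).
have rK u y : y \in kids g u -> rk m' y = rk m y.
  by move=> yu; apply: rE; apply: contraTneq yu => ->; rewrite (root_kid _ sh pw).
exists m' => //; split=> //.
  split=> // u i; rewrite ef /nranked ef /= updE.
  case: (eqVneq u w) => [->|uw] H.
    have {}H j : j < rk m w -> j < size (kids g w) /\
        rk m (nth 0 (kids g w) j) = rk m w - j.+1.
      by move=> Hj; apply: rg; rewrite /nranked fw.
    rewrite fw.
    case: (ranked) r' rwl => r' rwl; rewrite r' /=.
      rewrite updE eqxx; case: i => [|i] /=.
        by rewrite rE 1?eq_sym // subn1 rwl.
      rewrite ltnS => /H [H1 H2]; split=> //.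
      by rewrite (rK w) ?mem_nth // H2 subSS.
    move=> /H [H1 H2]; rewrite size_rcons nth_rcons H1 (rK w) ?mem_nth //.
    by split=> //; apply: ltnW.
  rewrite rE // => Hi; have [|H1 H2] := rg u i _ Hi; last first.
  - by rewrite (rK u) ?mem_nth.
  (* The loser becomes a child only now, but being full it was already subject to [ranks]. *)
  - move: H; rewrite /is_kid /= updE; case: (eqVneq u l) => [->|//].
    by rewrite fl.
set g' := add_kid _ g w l.
have := @sum_but1 _ (charge m' g') (charge m g) (dom g) w.
rewrite (sh_uniq sh) (sh_dom sh) (full_alloc fw) => /(_ isT isT) H.
have {}H : phi m' g' + charge m g w = phi m g + charge m' g' w.
  by apply: H => x _ xw; rewrite /charge ef rE //= updE (negPf xw).
move: H; rewrite /charge /= updE eqxx ef fw r'; have := full_size rg fw.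
by case: (ranked) => /=; rewrite ?size_rcons ?updE ?eqxx; lia.
Qed.

(** Emptying [u] weakens what [ranks] demands of it, while its [rk m u] ranked children now all
    count in [charge]. *)
Lemma hollowP m g u : forest m g -> full_at m u ->
  exists2 m', set_item m u None = Some m' & [/\ forest m' g,
    itm m' =1 upd (itm m) u None, rk m' =1 rk m & phi m' g = phi m g + rk m u].
Proof.
move=> [sh rg] fu; have [m' e [a' i' r' l' n']] := set_itemP None (full_alloc fu).
have ef x : full_at m' x = (x != u) && full_at m x.
  by rewrite /full_at i' updE; case: eqP.
exists m' => //; split=> //.
  split; first exact: shape_ext sh.
  move=> x i; rewrite /nranked ef !r'; case: (eqVneq x u) => [->|_]; last exact: rg.
  move=> /= _ Hi; apply: rg; rewrite /nranked fu //.
  by apply: leq_trans Hi _; apply: geq_minr.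
have := @sum_but1 _ (charge m' g) (charge m g) (dom g) u.
rewrite (sh_uniq sh) (sh_dom sh) (full_alloc fu) => /(_ isT isT) H.
have {}H : phi m' g + charge m g u = phi m g + charge m' g u.
  by apply: H => x _ xu; rewrite /charge ef xu r'.
move: H; rewrite /charge ef eqxx fu /=; have := full_size rg fu; lia.
Qed.

(** Every child of a hollow node counts in [charge], so each detachment releases one unit of [phi].
    The shortened list violates nothing, since [ranks] does not speak of hollow roots. *)
Lemma forest_pop m g u h f c : forest m g -> kids g u = f :: c ->
  ~~ full_at m u -> par g u = inr h ->
  exists2 m', pop_child m u = Some (f, m') &
    [/\ forest m' (free_kid g u h), itm m' =1 itm m, rk m' =1 rk m &
        (phi m' (free_kid g u h)).+1 = phi m g].
Proof.
move=> [sh rg] ku hu pu; have [m' e [sh' i' r']] := pop_childP h sh ku.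
have ef x := full_eq (i' x).
have du : u \in dom g.
  by have := sh_alloc sh (u := u) (x := f); rewrite ku mem_head => /(_ isT) /andP [].
exists m' => //; split=> //.
  split=> // x i; rewrite /nranked ef !r' /free_kid ku /is_kid /= !updE.
  case: (eqVneq x u) => [->|xu].
    rewrite (negPf hu) /=; case: eqP => //; by rewrite pu.
  move=> H Hi; apply: rg => //; move: H; case: eqP => // _.
  by rewrite orbF => ->.
have := @sum_but1 _ (charge m' (free_kid g u h)) (charge m g) (dom g) u.
rewrite (sh_uniq sh) du => /(_ isT isT) H.
have {}H : phi m' (free_kid g u h) + charge m g u =
    phi m g + charge m' (free_kid g u h) u.
  have dE : dom (free_kid g u h) = dom g by rewrite /free_kid ku.
  rewrite /phi dE; apply: H => x _ xu.
  by rewrite /charge ef r' /free_kid ku /= updE (negPf xu).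
move: H; rewrite /charge ef (negPf hu) /free_kid ku /= updE eqxx /=; lia.
Qed.

(** A free address reads as hollow and a childless node has charge 0, so neither [itm] nor [phi]
    changes. *)
Lemma forest_remove m g x h : forest m g -> par g x = inr h ->
  kids g x = [::] -> ~~ full_at m x -> alloc m x ->
  let m' := upd m x None in
  [/\ forest m' (remove_node g x), itm m' =1 itm m,
      forall y, y != x -> rk m' y = rk m y & phi m' (remove_node g x) = phi m g].
Proof.
move=> [sh rg] px kx hx ax m'.
have i' : itm m' =1 itm m.
  move=> y; rewrite /m' /itm updE; case: eqP => // ->.
  by move: hx; rewrite /full_at /itm; case: (m x) => // n; case: (item n).
have ef y := full_eq (i' y).
have r' y : y != x -> rk m' y = rk m y by rewrite /m' /rk updE => /negPf ->.
split=> //.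
  split; first exact: shape_remove_node sh px kx.
  move=> u i; rewrite /nranked ef; case: (eqVneq u x) => [->|ux].
    by rewrite (negPf hx) /is_kid /= px.
  rewrite !(r' u ux) => H Hi; have [H1 H2] := rg u i H Hi; split=> //.
  rewrite r' //; have := mem_nth 0 H1; apply: contraTneq => /= ->.
  by rewrite (root_kid _ sh px).
rewrite /phi [RHS](big_rem x) ?(sh_dom sh) //=.
have -> : charge m g x = 0 by rewrite /charge kx.
rewrite add0n.
apply: eq_big_seq => y; rewrite mem_rem_uniq ?(sh_uniq sh) // inE => /andP [yx _].
by rewrite /charge ef r'.
Qed.

Lemma forest_add m g x h (e : I) k : forest m g -> m x = None ->
  let m' := upd m x (Some (Node (Some e) k 0 None None)) in
  [/\ forest m' (add_node g x h 0), itm m' =1 upd (itm m) x (Some e) &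
      phi m' (add_node g x h 0) = phi m g].
Proof.
move=> [sh rg] mx m'.
have [sh' kx] := shape_add_node h 0 (Some e) k 0 sh mx.
have r' : rk m' =1 rk m.
  by move=> y; rewrite /m' /rk updE; case: eqP => // ->; rewrite mx.
have i' : itm m' =1 upd (itm m) x (Some e).
  by move=> y; rewrite /m' /itm !updE; case: eqP.
have ef y : y != x -> full_at m' y = full_at m y.
  by move=> yx; apply: full_eq; rewrite i' updE (negPf yx).
split=> //.
  split=> // u i; case: (eqVneq u x) => [->|ux].
    have rx : rk m x = 0 by rewrite /rk mx.
    by rewrite /nranked !r' rx; case: ifP.
  rewrite /nranked ef // !r' /is_kid /= updE (negPf ux).
  exact: rg.
rewrite /phi /= big_cons; have -> : charge m' (add_node g x h 0) x = 0.
  by rewrite /charge /= kx sub0n.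
rewrite add0n.
apply: eq_big_seq => y yd; have yx : y != x.
  by apply: contraTneq yd => ->; rewrite (sh_dom sh) /alloc mx.
by rewrite /charge ef // r'.
Qed.

(** Let [u] have rank r and s children, so that its charge is s - r. If r > 2, then [u] keeps two
    children, now charged, and [v], of rank r - 2 with s - 2 children, has charge s - r. If r <= 2,
    then all s children stay at the hollow [u] and [v] has charge 0. In both cases [phi] grows by at
    most 2. *)
Lemma decreaseP m g u nu p v h (e : I) k : forest m g -> m u = Some nu ->
  full_at m u -> par g u = inl p -> m v = None ->
  exists m1 m2 g',
    [/\ set_item (upd m v (Some (Node (Some e) k (rank nu - 2) None None)))
          u None = Some m1,
        (if 2 < rank nu then move_children m1 u v else Some m1) = Some m2 &
        [/\ forest m2 g', itm m2 =1 upd (upd (itm m) v (Some e)) u None,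
          phi m2 g' <= phi m g + 2, par g' v = inr h &
          forall x a, x != v -> par g x = inr a -> par g' x = inr a]].
Proof.
move=> [sh rg] mu fu pu mv.
have uv : u != v by apply: contraTneq fu => ->; rewrite /full_at /itm mv.
have [sh0 kv] := shape_add_node h (ht g u) (Some e) k (rank nu - 2) sh mv.
set m0 := upd m v _ in sh0 *; set g0 := add_node g v h _ in sh0.
have au0 : alloc m0 u by rewrite /alloc /m0 updE (negPf uv) mu.
have [m1 e1 [a1 i1 r1 l1 n1]] := set_itemP None au0.
have ru : rank nu = rk m u by rewrite /rk mu.
have sh1 : shape m1 g0 by apply: shape_ext sh0.
have i1E : itm m1 =1 upd (upd (itm m) v (Some e)) u None.
  by move=> x; rewrite i1 !updE; case: eqP => // _; rewrite /itm /m0 updE; case: eqP.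
have r1E : rk m1 =1 upd (rk m) v (rk m u - 2).
  by move=> x; rewrite r1 updE -ru /rk /m0 updE; case: eqP.
have vk w : v \in kids g w = false.
  by apply: contraTF isT => /(sh_alloc sh) /andP [_]; rewrite (sh_dom sh) /alloc mv.
have su := full_size rg fu.
have [m2 [g2 [e2 [sh2 i2 r2] [d2 k2 p2]]]] : exists m2 g2,
   [/\ (if 2 < rank nu then move_children m1 u v else Some m1) = Some m2,
     [/\ shape m2 g2, itm m2 =1 itm m1 & rk m2 =1 rk m1] &
     [/\ dom g2 = v :: dom g, forall w, kids g2 w =
          if 2 < rk m u then (if w == v then drop 2 (kids g u) else
             if w == u then take 2 (kids g u) else kids g w) else kids g w &
         forall x, par g2 x =
           if (2 < rk m u) && (x \in drop 2 (kids g u)) then inl v else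
           if x == v then inr h else par g x]].
  rewrite ru; case: leqP => H.
    by exists m1, g0; split.
  have s2 : 2 < size (kids g0 u) by apply: leq_trans su.
  have av1 : alloc m1 v by rewrite a1 /alloc /m0 updE eqxx.
  have [|m2 -> E] := move_childrenP sh1 s2 uv av1 kv.
    by rewrite /= !updE eqxx (negPf uv).
  by exists m2, (move_kids g0 u v).
exists m1, m2, g2; split=> //.
have i2E x : itm m2 x = upd (upd (itm m) v (Some e)) u None x by rewrite i2 i1E.
have efv : full_at m2 v by rewrite /full_at i2E !updE eq_sym (negPf uv) eqxx.
have efu : full_at m2 u = false by rewrite /full_at i2E updE eqxx.
have ef x : x != u -> x != v -> full_at m2 x = full_at m x.
  by move=> xu xv; rewrite /full_at i2E !updE (negPf xu) (negPf xv).
have r2v : rk m2 v = rk m u - 2 by rewrite r2 r1E updE eqxx.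
have r2E x : x != v -> rk m2 x = rk m x.
  by move=> xv; rewrite r2 r1E updE (negPf xv).
have rK w y : y \in kids g w -> rk m2 y = rk m y.
  by move=> H; apply: r2E; apply: contraTneq H => ->; rewrite vk.
have du2 x : x \in drop 2 (kids g u) -> par g x = inl u.
  by move/mem_drop; rewrite (sh_par sh) => /eqP.
split=> //.
- split=> // w i; rewrite k2; case: (eqVneq w v) => [->|wv].
    rewrite /nranked efv r2v => _ Hi; have -> : 2 < rk m u by lia.
    (* The child at index [i] of [v] was at index [2 + i] of [u]; the shift by 2 matches the
       difference of the ranks of [u] and [v]. *)
    have [||H1 H2] := rg u (2 + i); rewrite ?fu /nranked ?fu //; first lia.
    rewrite size_drop nth_drop (rK u) ?mem_nth //; lia.
  case: (eqVneq w u) => [->|wu].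
    rewrite /nranked efu r2E // => _ Hi.
    have [||H1 H2] := rg u i; rewrite ?fu /nranked ?fu //; first lia.
    case: ifP => H; last by rewrite (rK u) ?mem_nth.
    have i2' : i < 2 by lia.
    rewrite size_take nth_take // (rK u) ?mem_nth //.
    by case: ifP => //.
  rewrite if_same /nranked ef // r2E // => H Hi.
  have [|H1 H2] := rg w i _ Hi; last by rewrite (rK w) ?mem_nth.
  move: H; rewrite /is_kid p2 (negPf wv); case: ifP => // /andP [_ /du2 pw].
  by rewrite pw.
- have vd : v \notin dom g by rewrite (sh_dom sh) /alloc mv.
  have := @sum_but1 _ (charge m2 g2) (charge m g) (dom g) u.
  rewrite (sh_uniq sh) (sh_dom sh) (full_alloc fu) => /(_ isT isT) H.
  have {}H : \sum_(x <- dom g) charge m2 g2 x + charge m g u = phi m g + charge m2 g2 u.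
    apply: H => x xd xu; have xv : x != v by apply: contraNneq vd => <-.
    by rewrite /charge ef // r2E // k2 (negPf xu) (negPf xv) if_same.
  have cu : charge m g u = size (kids g u) - rk m u by rewrite /charge fu.
  have cu2 : charge m2 g2 u = size (kids g2 u) by rewrite /charge efu subn0.
  have cv2 : charge m2 g2 v = size (kids g2 v) - (rk m u - 2).
    by rewrite /charge efv r2v.
  rewrite {1}/phi d2 big_cons; move: H.
  rewrite cu cu2 cv2 !k2 !eqxx (negPf uv) kv; case: ltnP => Hr /=; last by lia.
  by rewrite size_drop size_take; case: ltnP; lia.
- by rewrite p2 eqxx; case: ifP => // /andP [_ /mem_drop]; rewrite vk.
- move=> x a xv px; rewrite p2 (negPf xv); case: ifP => // /andP [_ /du2].
  by rewrite px.
Qed.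

End Forest.

(** * Descendants and the logarithmic bound on ranks *)

Section Trees.
Context {disp : Order.disp_t} {K : orderType disp} {I : eqType}.
Implicit Types (m : memory K I) (x y z u v w l r : loc) (g : ghost).

(** The inductive relation walks along the circle from the last child; the successor of the last
    child is the first, so the walk meets every child. *)
Lemma child_ofP m g u x : shape m g -> child_of m u x <-> x \in kids g u.
Proof.
move=> sh; split.
  elim=> [nu v mu lu|v nv w _ IH mv nE].
    have oz : olast (kids g u) = Some v by rewrite -(sh_last sh) /la mu.
    exact: olast_mem oz.
  have := sh_next sh IH; rewrite /ne mv nE => -[->].
  by rewrite mem_next.
move=> xu; have ax : alloc m u.
  by have /andP [] := sh_alloc sh xu; rewrite (sh_dom sh).
have [nu mu] := allocP ax.
case oz: (olast (kids g u)) => [z|]; last by case: (kids g u) xu oz.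
have cz : child_of m u z.
  by apply: (child_last mu); move: (sh_last sh u); rewrite /la mu oz.
have step v : v \in kids g u -> child_of m u v -> child_of m u (next (kids g u) v).
  move=> vu cv; have /andP [_ av] := sh_alloc sh vu; rewrite (sh_dom sh) in av.
  have [nv mv] := allocP av.
  by apply: (child_next cv mv); move: (sh_next sh vu); rewrite /ne mv.
have all_kids i : i < size (kids g u) -> child_of m u (nth z (kids g u) i).
  elim: i => [|i IH] Hi.
    by rewrite nth0 -(next_last (sh_kids sh u) oz); apply: step => //; apply: olast_mem.
  rewrite -next_nthS ?(sh_kids sh) //; apply: step; last by apply: IH; apply: ltnW.
  by apply: mem_nth; apply: ltnW.
by rewrite -(nth_index z xu); apply: all_kids; rewrite index_mem.
Qed.

Lemma in_tree_alloc m g r x : shape m g -> alloc m r -> in_tree m r x -> alloc m x.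
Proof.
move=> sh ar; elim=> // u v _ _ /(child_ofP _ _ sh) vu.
by have /andP [_] := sh_alloc sh vu; rewrite (sh_dom sh).
Qed.

Lemma in_tree_kid m g r x : shape m g -> in_tree m r x -> x <> r ->
  exists u, par g x = inl u.
Proof.
move=> sh [//|u v _ /(child_ofP _ _ sh) vu _].
by exists u; apply/eqP; rewrite -(sh_par sh).
Qed.

(** Closure under taking children. A closed set contains the descendants of its members, so its size
    bounds their ranks, and it may stay the same while nodes are being destroyed. *)
Definition closed g (s : seq loc) :=
  forall x u, par g x = inl u -> u \in s -> x \in s.

(** Roots are fixed points, so that iterating [up] is always defined and [below] is the reflexive
    descendant relation. *)
Definition up g x : loc := if par g x is inl u then u else x.
Definition below g x y := exists n, iter n (up g) y = x.

Lemma closed_below g s x y : closed g s -> x \in s -> below g x y -> y \in s.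
Proof.
move=> cs xs [n]; elim: n y => [|n IH] y; first by move=> /= ->.
rewrite iterSr => /IH; rewrite /up; case p: (par g y) => [u|h] //.
exact: cs p.
Qed.

Lemma below_trans g x y z : below g x y -> below g y z -> below g x z.
Proof. by move=> [n e] [k e']; exists (n + k); rewrite iterD e' e. Qed.

Lemma below_kid m g x y : shape m g -> y \in kids g x -> below g x y.
Proof.
by move=> sh; rewrite (sh_par sh) => /eqP p; exists 1; rewrite /= /up p.
Qed.

Lemma below_ht m g x y : shape m g -> below g x y -> ht g y <= ht g x.
Proof.
move=> sh [n <-]; elim: n => //= n IH; apply: leq_trans IH _.
rewrite {2}/up; case p: (par g _) => [u|//].
by apply/ltnW/(sh_ht sh); rewrite (sh_par sh) p.
Qed.

(** On the way up from [y], let [a] be met first. If [b] is met strictly later, then it is met at or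
    above the parent [x] of [a], hence has at least the height of [x], although it is a child of
    [x]. *)
Lemma below_siblings m g x a b y : shape m g -> a \in kids g x ->
  b \in kids g x -> below g a y -> below g b y -> a = b.
Proof.
move=> sh; wlog: a b / (exists n k, iter n (up g) y = a /\ iter (k + n) (up g) y = b).
  move=> W ak bk [n en] [k ek]; case: (leqP n k) => nk.
    by apply: W => //; [exists n, (k - n); rewrite subnK|exists n|exists k].
  symmetry; apply: W => //; [|by exists k|by exists n].
  by exists k, (n - k); rewrite subnK // ltnW.
move=> [n [k [en ek]]] ak bk _ _; move: ek; rewrite iterD en.
case: k => [//|k]; rewrite iterSr.
have -> : up g a = x by move: ak; rewrite (sh_par sh) /up => /eqP ->.
move=> ek; have : below g b x by exists k.
by move/(below_ht sh); have := sh_ht sh bk; lia.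
Qed.

(** Induction on the rank r: the children of ranks r - 1 and r - 2 have disjoint sets of descendants
    by [below_siblings], each of at least 2^((r-2)/2) nodes, with the exponent rounded down. *)
Lemma tree_size m g x : forest m g -> full_at m x || is_kid g x ->
  exists d, [/\ uniq d, 2 ^ (rk m x)./2 <= size d & forall y, y \in d -> below g x y].
Proof.
move=> [sh rg]; have [n] := ubnP (rk m x); elim: n x => // n IH x.
rewrite ltnS => Hn gx.
case: (ltnP (rk m x) 2) => r2.
  exists [:: x]; split=> //; first by case: (rk m x) r2 => [|[|]].
  by move=> y; rewrite inE => /eqP ->; exists 0.
have kid i : i < 2 -> exists d, [/\ uniq d, 2 ^ (rk m x - i.+1)./2 <= size d &
    forall y, y \in d -> below g (nth 0 (kids g x) i) y].
  move=> i2; have [|H1 H2] := rg x i gx; first by rewrite /nranked; case: ifP; lia.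
  have kx := mem_nth 0 H1; rewrite -H2; apply: IH; first by lia.
  by move: kx; rewrite (sh_par sh) /is_kid orbC => /eqP ->.
have H1 : 1 < size (kids g x).
  by case: (rg x 1 gx) => //; rewrite /nranked; case: ifP; lia.
have [d0 [u0 s0 b0]] := kid 0 isT; have [d1 [u1 s1 b1]] := kid 1 isT.
have k0 : nth 0 (kids g x) 0 \in kids g x by rewrite mem_nth // ltnW.
have k1 : nth 0 (kids g x) 1 \in kids g x by rewrite mem_nth.
exists (d0 ++ d1); split.
- rewrite cat_uniq u0 u1 andbT /=; apply/hasPn => y y1; apply/negP => y0.
  have /eqP := below_siblings sh k0 k1 (b0 y y0) (b1 y y1).
  by rewrite nth_uniq ?(sh_kids sh) // ltnW.
- rewrite size_cat; move: Hn r2 s0 s1; case: (rk m x) => [//|[//|r]] _ _.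
  rewrite subn1 subn2 /= expnS => s0 s1.
  have : 2 ^ r./2 <= 2 ^ (uphalf r) by rewrite leq_exp2l //; lia.
  by move: s0 s1; rewrite /=; lia.
- move=> y; rewrite mem_cat => /orP [/b0|/b1].
    by apply: below_trans; apply: below_kid sh k0.
  by apply: below_trans; apply: below_kid sh k1.
Qed.

(** The largest r whose half, rounded down, is at most [trunc_log 2 N]. *)
Definition max_rank N := (trunc_log 2 N).*2.+1.

Lemma rank_bound m g s x : forest m g -> full_at m x || is_kid g x ->
  closed g s -> x \in s -> rk m x <= max_rank (size s).
Proof.
move=> fg gx cs xs; have [d [ud sd bd]] := tree_size fg gx.
have ds : size d <= size s.
  by apply: uniq_leq_size => // y /bd; apply: closed_below cs xs.
have : (rk m x)./2 <= trunc_log 2 (size s).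
  by apply: trunc_log_max => //; apply: leq_trans ds.
rewrite /max_rank; lia.
Qed.

End Trees.

(** * Linking and melding of full roots *)

Section Linking.
Context {disp : Order.disp_t} {K : orderType disp} {I : eqType}.
Implicit Types (m : memory K I) (x y z u v w l r : loc) (g : ghost).

Definition root_at m g h x := par g x = inr h /\ full_at m x.

Lemma linkP (ranked : bool) m g x y w m' a b : forest m g -> x != y ->
  root_at m g a x -> root_at m g b y -> (ranked -> rk m x = rk m y) ->
  link ranked m x y w m' ->
  exists l g', [/\ (w = x /\ l = y) \/ (w = y /\ l = x),
    par g' = upd (par g) l (inl w), forest m' g', itm m' =1 itm m &
    rk m' =1 (if ranked then upd (rk m) w (rk m w).+1 else rk m) /\
    phi m' g' = phi m g + ~~ ranked].
Proof.
move=> fg xy [px fx] [py fy] rxy [nx ny m1 mx my _|nx ny m1 mx my _].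
  have [m2 -> [f2 i2 r2 p2]] := link_toP fg xy px py fx fy rxy; case=> <-.
  by exists y, (add_kid (~~ ranked) g x y); split=> //; left.
rewrite eq_sym in xy; have ryx := fun e => esym (rxy e).
have [m2 -> [f2 i2 r2 p2]] := link_toP fg xy py px fy fx ryx; case=> <-.
by exists x, (add_kid (~~ ranked) g y x); split=> //; right.
Qed.

Lemma link_exists (ranked : bool) m g x y a b : forest m g -> x != y ->
  root_at m g a x -> root_at m g b y -> (ranked -> rk m x = rk m y) ->
  exists w m', link ranked m x y w m'.
Proof.
move=> fg xy [px fx] [py fy] rxy.
have [nx mx] := allocP (full_alloc fx); have [ny my] := allocP (full_alloc fy).
case/orP: (Order.TotalTheory.le_total (key nx) (key ny)) => le.
  have [m' e _] := link_toP fg xy px py fx fy rxy.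
  by exists x, m'; apply: link_left mx my le e.
rewrite eq_sym in xy; have ryx := fun e => esym (rxy e).
have [m' e _] := link_toP fg xy py px fy fx ryx.
by exists y, m'; apply: link_right mx my le e.
Qed.

Definition oroot_at m g h (o : option loc) := forall x, o = Some x -> root_at m g h x.

(** The remaining root is relabelled from [a] or [b] to [h], and roots of third heaps keep their
    labels. The only cost in [phi] is the unit of an unranked link. *)
Lemma meldP m g h (r1 r2 r' : option loc) m' a b : forest m g ->
  oroot_at m g a r1 -> oroot_at m g b r2 -> (r1 <> r2 \/ r1 = None) ->
  meld_roots m r1 r2 r' m' ->
  exists g', [/\ forest m' g', itm m' =1 itm m, phi m' g' <= (phi m g).+1,
    oroot_at m' g' h r' &
    forall z c, c <> a -> c <> b -> par g z = inr c -> par g' z = inr c].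
Proof.
(* When one argument is empty, the root of the other, if any, is only relabelled. *)
have single o d : forest m g -> oroot_at m g d o -> exists g',
    [/\ forest m g', phi m g' <= (phi m g).+1, oroot_at m g' h o &
    forall z c, c <> d -> par g z = inr c -> par g' z = inr c].
  move=> fg; case: o => [x|] ro; last by exists g; split.
  have [px fx] := ro x erefl; have [f' p'] := forest_retag h px fg.
  exists (retag g x h); split=> //.
    by move=> y [<-]; split=> //=; rewrite updE eqxx.
  move=> z c cd pz; rewrite /= updE; case: eqP => // e; case: cd.
  by move: pz; rewrite e px => -[].
move=> fg r1a r2b r12 me; case: me r1a r2b r12 => [r|r|x y w m1 lk] r1a r2b r12.
- have [g' [H1 H2 H3 H4]] := single _ _ fg r2b.
  by exists g'; split=> // z c _; apply: H4.
- have [g' [H1 H2 H3 H4]] := single _ _ fg r1a.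
  by exists g'; split=> // z c ca _; apply: H4.
have xy : x != y by apply/eqP => e; case: r12 => // -[]; rewrite e.
have nf : false -> rk m x = rk m y by [].
have [l [g' [wl pg' f' i' [_ p']]]] := linkP fg xy (r1a x erefl) (r2b y erefl) nf lk.
have [px fx] := r1a x erefl; have [py fy] := r2b y erefl.
have [d pw] : exists d, par g' w = inr d.
  rewrite pg' updE; case: wl => -[-> ->].
    by rewrite (negPf xy) px; exists a.
  by rewrite eq_sym (negPf xy) py; exists b.
have fw : full_at m1 w by rewrite (full_eq (i' w)); case: wl => -[->].
have [f'' p''] := forest_retag h pw f'.
exists (retag g' w h); split=> //.
- by rewrite p'' p' addn1.
- by move=> z [<-]; split=> //=; rewrite updE eqxx.
move=> z c ca cb pz; have zx : z != x.
  by apply/eqP => e; move: pz; rewrite e px => -[/esym].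
have zy : z != y by apply/eqP => e; move: pz; rewrite e py => -[/esym].
rewrite /= updE pg' updE.
by case: wl => -[-> ->]; rewrite (negPf zx) (negPf zy).
Qed.

Lemma meld_exists m g (r1 r2 : option loc) a b : forest m g ->
  oroot_at m g a r1 -> oroot_at m g b r2 -> (r1 <> r2 \/ r1 = None) ->
  exists (r' : option loc) m', meld_roots m r1 r2 r' m'.
Proof.
move=> fg; case: r1 => [x|]; last by exists r2, m; constructor.
case: r2 => [y|] rx ry xy; last by exists (Some x), m; constructor.
have {}xy : x != y by apply/eqP => e; case: xy => // -[]; rewrite e.
have nf : false -> rk m x = rk m y by [].
have [w [m' lk]] := link_exists fg xy (rx x erefl) (ry y erefl) nf.
by exists (Some w), m'; constructor.
Qed.

End Linking.

(** * The correspondence between items and the nodes that hold them *)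

Section Items.
Variable I : eqType.
Implicit Types (f : loc -> option I) (n : I -> option loc).

(** Mutually inverse partial maps: no item is held by two nodes. *)
Definition inverse f n := forall x e, f x = Some e <-> n e = Some x.

Lemma inverse_ext f n f' n' : f' =1 f -> n' =1 n -> inverse f n -> inverse f' n'.
Proof. by move=> ef en H x e; rewrite ef en. Qed.

Lemma inverse_remove f n u e : inverse f n -> n e = Some u ->
  inverse (upd f u None) (upd n e None).
Proof.
move=> H ne x e'; rewrite !updE; case: (eqVneq x u) => [->|xu].
  case: (eqVneq e' e) => // e'e; split=> // /H fu; case/eqP: e'e.
  by move/H: ne; rewrite fu => -[].
case: (eqVneq e' e) => [->|_]; last exact: H.
by split=> // /H; rewrite ne => -[e1]; rewrite e1 eqxx in xu.
Qed.

Lemma inverse_add f n x e : inverse f n -> f x = None -> n e = None ->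
  inverse (upd f x (Some e)) (upd n e (Some x)).
Proof.
move=> H fx ne y e'; rewrite !updE; case: (eqVneq y x) => [->|yx].
  case: (eqVneq e' e) => [->//|e'e]; split=> [[e1]|/H]; last by rewrite fx.
  by rewrite e1 eqxx in e'e.
case: (eqVneq e' e) => [->|_]; last exact: H.
by split=> [/H|[e1]]; [rewrite ne|rewrite e1 eqxx in yx].
Qed.

End Items.

Lemma perm_rem_cat (T : eqType) (P F : seq T) x : x \in P ->
  perm_eq (rem x P ++ x :: F) (P ++ F).
Proof.
move=> xP; apply/permP => a; rewrite !count_cat /=.
by have /permP /(_ a) /= -> := perm_to_rem xP; lia.
Qed.

(** The number of roots in the array, provided that no cell beyond [mr] is occupied. *)
Definition stored (a : nat -> option loc) mr := \sum_(0 <= i < mr.+1) isSome (a i).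

Lemma stored_widen a mr mr' : (forall i, mr < i -> a i = None) -> mr <= mr' ->
  stored a mr' = stored a mr.
Proof.
move=> H le; rewrite /stored (@big_cat_nat _ _ _ mr.+1) //=.
rewrite [X in _ + X](_ : _ = 0) ?addn0 //.
by rewrite big_nat_cond big1 // => i /andP [/andP [/H -> _] _].
Qed.

Lemma stored_upd a mr i o : i <= mr ->
  stored (upd a i o) mr + isSome (a i) = stored a mr + isSome o.
Proof.
move=> le; have := @sum_but1 _ (fun j => isSome (upd a i o j) : nat)
  (fun j => isSome (a j) : nat) (index_iota 0 mr.+1) i.
rewrite iota_uniq mem_index_iota ltnS le updE eqxx => -> // x _ xi.
by rewrite updE (negPf xi).
Qed.

(** * Invariants of the machine and its potential *)

Section Machine.
Context {disp : Order.disp_t} {K : orderType disp} {I : eqType}.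
Implicit Types (st : state K I) (m : memory K I) (x y z u v w l r : loc).
Implicit Types (g : ghost) (h : handle).

(* While a deletion on the heap [h] is running, the value of [h] is stale. *)
Record state_inv (busy : option handle) st g : Prop := StateInv {
  si_forest : forest (Defs.mem st) g;
  si_items : inverse (itm (Defs.mem st)) (node_of st);
  si_heaps : forall h r, Some h <> busy -> heaps st h = Some (Some r) ->
    root_at (Defs.mem st) g h r }.

Definition busy (k : control) : option handle :=
  match k with
  | Idle => None
  | Destroying h _ _ | RankedLinking h _ _ | Scanning h _ _ _
  | UnrankedLinking h _ => Some h
  end.

Definition roots_at m g h (s : seq loc) := forall x, x \in s -> root_at m g h x.

(* In the first two phases, [s] lists nodes of the heap, [N] in number, that
   include all the nodes that are left: it bounds the ranks. *)
Definition control_inv st g N (k : control) : Prop :=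
  match k with
  | Idle => forall i, array st i = None
  | Destroying h P F =>
      [/\ forall i, array st i = None, uniq (P ++ F),
        forall x, x \in P -> par g x = inr h /\ alloc (Defs.mem st) x,
        roots_at (Defs.mem st) g h F &
        exists s, [/\ size s = N, closed g s & {subset P ++ F <= s}]]
  | RankedLinking h F mr =>
      [/\ uniq F, roots_at (Defs.mem st) g h F,
        forall i y, array st i = Some y ->
          [/\ y \notin F, rk (Defs.mem st) y = i, i <= mr &
            root_at (Defs.mem st) g h y],
        mr <= max_rank N &
        exists s, [/\ size s = N, closed g s, {subset F <= s} &
          forall i y, array st i = Some y -> y \in s]]
  | Scanning h i mr G =>
      [/\ uniq G, roots_at (Defs.mem st) g h G,
        forall j y, array st j = Some y ->
          [/\ y \notin G, rk (Defs.mem st) y = j, i <= j <= mr &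
            root_at (Defs.mem st) g h y],
        mr <= max_rank N & i <= mr.+1]
  | UnrankedLinking h G =>
      [/\ forall i, array st i = None, uniq G & roots_at (Defs.mem st) g h G]
  end.

(** The transitions of the rest of the scan, its end included; then 5 for each root already in the
    list and for each cell still to be read, which may contain a root; and 2 that cover the end of
    the deletion. *)
Definition scan_cost mr i G := (mr.+2 - i) + 5 * ((mr.+1 - i) + G) + 2.
(** The scan of the longest possible array, and one transition to begin it. *)
Definition link_cost N := (scan_cost (max_rank N) 0 0).+1.

(** A root to be examined has 3 credits, a full root 2, a stored root 1: passing to the next class
    releases one credit, and so does a ranked link, which empties a cell and preserves the length of
    [F]. With 4 credits per unit of [phi], a detached child releases 4 and retains 3; an unranked
    link releases 5, of which 4 pay for the growth of [phi]. *)
Definition credit st N (k : control) : nat :=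
  match k with
  | Idle => 0
  | Destroying h P F => 3 * size P + 2 * size F + (link_cost N).+1
  | RankedLinking h F mr => 2 * size F + stored (array st) mr + link_cost N
  | Scanning h i mr G => scan_cost mr i (size G)
  | UnrankedLinking h G => 5 * size G + 1
  end.

Definition potential st g N k := 4 * phi (Defs.mem st) g + credit st N k.

Definition good (c : config K I) g N :=
  state_inv (busy c.2) c.1 g /\ control_inv c.1 g N c.2.

Lemma closed_upd g g' s l w : closed g s -> par g' = upd (par g) l (inl w) ->
  l \in s -> closed g' s.
Proof.
move=> cs e ls x u; rewrite e updE; case: (eqVneq x l) => [-> //|_].
exact: cs.
Qed.

End Machine.

(** * The transitions of a deletion: cost and progress *)

Section Steps.
Context {disp : Order.disp_t} {K : orderType disp} {I : eqType}.
Implicit Types (st : state K I) (m : memory K I) (x y z u v w l r : loc).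
Implicit Types (g : ghost) (h : handle).

Lemma full_atE m x n : m x = Some n -> full_at m x = full n.
Proof. by rewrite /full_at /itm /full => ->; case: (item n). Qed.

Lemma rkE m x n : m x = Some n -> rk m x = rank n.
Proof. by rewrite /rk => ->. Qed.

Lemma state_inv_ext b st g st' g' : state_inv b st g -> forest (Defs.mem st') g' ->
  itm (Defs.mem st') =1 itm (Defs.mem st) -> node_of st' = node_of st ->
  heaps st' = heaps st ->
  (forall h r, Some h <> b -> par g r = inr h -> par g' r = inr h) ->
  state_inv b st' g'.
Proof.
move=> [f i hs] f' i' en eh p; split=> //.
  by rewrite en; apply: inverse_ext i.
move=> h r hb; rewrite eh => /(hs h r hb) [pr fr].
by split; [apply: p|rewrite (full_eq (i' r))].
Qed.

(** Both roots belong to the heap [h]. The conclusions are what a deletion needs: its other roots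
    survive, other heaps are untouched, and a closed set containing both roots stays closed. *)
Lemma link_rootsP (ranked : bool) m g h x y w m' : forest m g -> x != y ->
  root_at m g h x -> root_at m g h y -> (ranked -> rk m x = rk m y) ->
  link ranked m x y w m' ->
  exists g', [/\ forest m' g', itm m' =1 itm m,
    rk m' =1 (if ranked then upd (rk m) w (rk m w).+1 else rk m) /\
    phi m' g' = phi m g + ~~ ranked,
    (w = x \/ w = y) /\ root_at m' g' h w &
    [/\ forall z, z != x -> z != y -> root_at m g h z -> root_at m' g' h z,
        forall z c, Some c <> Some h -> par g z = inr c -> par g' z = inr c &
        forall s, closed g s -> x \in s -> y \in s -> closed g' s]].
Proof.
move=> fg xy rx ry rxy lk.
have [l [g' [wl pg' f' i' rp]]] := linkP fg xy rx ry rxy lk.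
have [px fx] := rx; have [py fy] := ry.
have lxy : l = x \/ l = y by case: wl => -[_ ->]; [right|left].
have pl : par g l = inr h by case: lxy => ->.
exists g'; split=> //.
  split; first by case: wl => -[-> _]; [left|right].
  split; last by rewrite (full_eq (i' w)); case: wl => -[->].
  by rewrite pg' updE; case: wl => -[-> ->]; rewrite ?(negPf xy) 1?eq_sym ?(negPf xy).
split.
- move=> z zx zy [pz fz]; split; last by rewrite (full_eq (i' z)).
  by rewrite pg' updE; case: lxy => ->; rewrite ?(negPf zx) ?(negPf zy).
- move=> z c ch pz; rewrite pg' updE; case: eqP => // e; case: ch.
  by move: pz; rewrite e pl => -[->].
- by move=> s cs xs ys; apply: closed_upd cs pg' _; case: lxy => ->.
Qed.

Lemma size_remS (s : seq loc) x : x \in s -> size s = (@size loc (rem x s)).+1.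
Proof. by move=> xs; rewrite size_rem // prednK //; case: s xs. Qed.

Lemma last_kids m g u n : shape m g -> m u = Some n -> Defs.last n = olast (kids g u).
Proof. by move=> sh mu; rewrite -(sh_last sh) /la mu. Qed.

(** The strict decrease of the potential pays for the transition. *)
Lemma step_good st k c g N : good (st, k) g N -> step st k c ->
  exists g', good c g' N /\ potential c.1 g' N c.2 < potential st g N k.
Proof.
move=> [si ci] sk; case: sk si ci => /= {k c}.
- move=> h P F x nx xP mx fx si [a0 uPF rP rF [s [sN cs ss]]].
  have pPF := perm_rem_cat F xP.
  exists g; split; last first.
    by rewrite /potential /= (size_remS xP); lia.
  split=> //; split=> //=.
  + by rewrite (perm_uniq pPF).
  + by move=> y /mem_rem; apply: rP.
  + move=> y; rewrite inE => /orP [/eqP ->|]; last exact: rF.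
    by have [px _] := rP x xP; split=> //; rewrite (full_atE mx).
  + by exists s; split=> // y; rewrite (perm_mem pPF); apply: ss.
- move=> h P F x nx f m' xP mx fx lx pop si [a0 uPF rP rF [s [sN cs ss]]].
  have [sh rg] := si_forest si.
  have [px ax] := rP x xP.
  case kx: (kids g x) => [|f' kc]; first by rewrite (last_kids sh mx) kx in lx.
  have hx : ~~ full_at (Defs.mem st) x by rewrite (full_atE mx).
  have [m2 e [f2 i2 r2 p2]] := forest_pop (si_forest si) kx hx px.
  move: pop; rewrite e => -[e1 e2]; subst f' m2.
  have pf : par g f = inl x by apply/eqP; rewrite -(sh_par sh) kx mem_head.
  have dE : dom (free_kid g x h) = dom g by rewrite /free_kid kx.
  have pE : par (free_kid g x h) = upd (par g) f (inr h) by rewrite /free_kid kx.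
  have aE z : alloc m' z = alloc (Defs.mem st) z.
    by rewrite -(sh_dom (proj1 f2)) dE (sh_dom sh).
  (* As a child of [x], the node [f] is not a root: it is new to [P ++ F], and the label of no root
     changes. *)
  have notf z c : par g z = inr c -> z != f by apply: contra_eqN => /eqP ->; rewrite pf.
  have par' z c : par g z = inr c -> par (free_kid g x h) z = inr c.
    by move=> pz; rewrite pE updE (negPf (notf z c pz)).
  have fPF : f \notin P ++ F.
    apply/negP; rewrite mem_cat => /orP [/rP [H _]|/rF [H _]];
      by have := notf _ _ H; rewrite eqxx.
  exists (free_kid g x h); split; last by rewrite /potential /=; lia.
  split; first by apply: (state_inv_ext si) => //= c r _; apply: par'.
  split=> //=.
  + by rewrite fPF.
  + move=> y; rewrite inE aE => /orP [/eqP ->|/rP [py ay]].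
      split; first by rewrite pE updE eqxx.
      have fx' : f \in kids g x by rewrite kx mem_head.
      by have /andP [_] := sh_alloc sh fx'; rewrite (sh_dom sh).
    by split=> //; apply: par'.
  + by move=> y /rF [py fy]; split; [apply: par'|rewrite (full_eq (i2 y))].
  + exists s; split=> //.
      move=> z u; rewrite pE updE; case: eqP => // _; exact: cs.
    move=> y; rewrite inE => /orP [/eqP ->|]; last exact: ss.
    by apply: cs pf _; apply: ss; rewrite mem_cat xP.
- move=> h P F x nx xP mx fx lx si [a0 uPF rP rF [s [sN cs ss]]].
  have [sh rg] := si_forest si.
  have [px ax] := rP x xP.
  have kx : kids g x = [::].
    by move: lx; rewrite (last_kids sh mx); case: (kids g x).
  have hx : ~~ full_at (Defs.mem st) x by rewrite (full_atE mx).
  have [f2 i2 r2 p2] := forest_remove (si_forest si) px kx hx ax.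
  have uP : uniq P by move: uPF; rewrite cat_uniq => /andP [].
  exists (remove_node g x); split; last first.
    by rewrite /potential /= p2 (size_remS xP); lia.
  split; first by apply: (state_inv_ext si).
  split=> //=.
  + by apply: subseq_uniq uPF; apply: cat_subseq; rewrite ?rem_subseq.
  + move=> y; rewrite mem_rem_uniq // inE => /andP [yx /rP [py ay]].
    by split=> //; rewrite /alloc updE (negPf yx).
  + by move=> y /rF [py fy]; split=> //; rewrite (full_eq (i2 y)).
  + exists s; split=> // y; rewrite mem_cat => H; apply: ss; rewrite mem_cat.
    by case/orP: H => [/mem_rem|] ->; rewrite ?orbT.
- move=> h F si [a0 uF _ rF [s [sN cs ss]]].
  have e0 : stored (array st) 0 = 0 by rewrite /stored big_nat1 a0.
  exists g; split; last by rewrite /potential /= e0; lia.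
  split=> //; split=> //= [i y|]; first by rewrite a0.
  by exists s; split=> // i y; rewrite a0.
- move=> h F mr x nx xF mx ax si [uF rF ra mrN [s [sN cs ss sa]]].
  rewrite -(rkE mx) in ax *; set r := rk _ x in ax *.
  have [px fx] := rF x xF.
  (* [x] is full and lies in the closed set [s] of size [N], so the index of its cell is within the
     part of the array whose scan is prepaid. *)
  have rN : r <= max_rank N.
    by rewrite -sN; apply: rank_bound (si_forest si) _ cs (ss x xF); rewrite fx.
  (* Cells above [mr] are empty, so raising [mr] to the rank of [x] does not change [stored]. *)
  have out i : mr < i -> array st i = None.
    move=> H; case e: (array st i) => [y|//].
    by case: (ra i y e) => _ _; rewrite leqNgt H.
  have := @stored_upd (array st) (maxn mr r) r (Some x) (leq_maxr _ _).
  rewrite ax (stored_widen out (leq_maxl _ _)) /= => sE.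
  exists g; split; last first.
    by rewrite /potential /= (size_remS xF); lia.
  split; first by apply: (state_inv_ext si) => //; apply: si_forest si.
  have mF y : y \in rem x F -> y \in F by apply: mem_rem.
  split=> /=.
  + exact: rem_uniq.
  + by move=> y /mF; apply: rF.
  + move=> i y; rewrite updE; case: eqP => [->|_].
      by case=> <-; rewrite mem_rem_uniq // inE eqxx leq_maxr.
    move=> /ra [yF ry im ry']; split=> //; last by rewrite leq_max im.
    by apply: contra yF; apply: mF.
  + by rewrite geq_max mrN.
  + exists s; split=> // [y /mF|i y]; first exact: ss.
    by rewrite updE; case: eqP => [_ [<-]|_]; [apply: ss|apply: sa].
- move=> h F mr x nx y w m' xF mx ay lk si [uF rF ra mrN [s [sN cs ss sa]]].
  rewrite -(rkE mx) in ay *; set r := rk _ x in ay *.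
  have [yF ry rmr roy] := ra _ _ ay.
  have xy : x != y by apply: contraNneq yF => <-.
  have [g' [f' i' [r' p'] [wxy row] [H1 H2 H3]]] :=
    link_rootsP (si_forest si) xy (rF x xF) roy (fun _ => esym ry) lk.
  have sE := @stored_upd (array st) mr r None rmr; rewrite ay /= in sE.
  exists g'; split; last first.
    by rewrite /potential /= p' (size_remS xF) /=; lia.
  split; first by apply: (state_inv_ext si) => // c z; apply: H2.
  have mF z : z \in rem x F -> [/\ z \in F, z != x & z != y].
    rewrite mem_rem_uniq // inE => /andP [zx zF]; split=> //.
    by apply: contraNneq yF => <-.
  have wF : w \notin rem x F.
    by apply/negP => /mF [_ wx wy]; case: wxy wx wy => ->; rewrite eqxx.
  split=> //=.
  + by rewrite wF rem_uniq.
  + move=> z; rewrite inE => /orP [/eqP -> //|/mF [zF zx zy]].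
    by apply: H1 => //; apply: rF.
  + move=> i z; rewrite updE; case: eqP => // /eqP ir az.
    have [zF rz im roz] := ra i z az.
    have zx : z != x by apply: contraNneq zF => ->.
    (* Roots in different cells have different ranks. *)
    have zy : z != y by apply: contra_neq ir => zy; rewrite -rz zy ry.
    have zw : z != w by case: wxy => ->.
    split=> //; last exact: H1.
      by rewrite inE negb_or zw; apply: contra zF => /mF [].
    by rewrite r' updE (negPf zw).
  + have xs := ss x xF; have ys := sa _ _ ay.
    exists s; split=> //; first exact: H3.
      move=> z; rewrite inE => /orP [/eqP ->|/mF [zF _ _]]; last exact: ss.
      by case: wxy => ->.
    by move=> i z; rewrite updE; case: eqP => // _; apply: sa.
- move=> h mr si [_ _ ra mrN _].
  exists g; split; last by rewrite /potential /= /link_cost /scan_cost; lia.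
  split=> //; split=> //= j y /ra [_ ry jm roy]; by split.
- move=> h i mr G im ai si [uG rG ra mrN _].
  exists g; split; last by rewrite /potential /= /scan_cost; lia.
  split=> //; split=> //= j y aj; have [yG ry /andP [ij jm] roy] := ra j y aj.
  by split=> //; rewrite jm andbT ltn_neqAle ij andbT;
    apply: contra_eq_neq aj => <-; rewrite ai.
- move=> h i mr G x im ai si [uG rG ra mrN _].
  have [xG rx _ rox] := ra i x ai.
  exists g; split; last by rewrite /potential /= /scan_cost; lia.
  split; first by apply: (state_inv_ext si) => //; apply: si_forest si.
  split=> //=.
  + by rewrite xG.
  + by move=> y; rewrite inE => /orP [/eqP ->|]; [|apply: rG].
  + move=> j y; rewrite updE; case: eqP => // /eqP ji aj.
    have [yG ry /andP [ij jm] roy] := ra j y aj; split=> //.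
      rewrite inE negb_or yG andbT; apply: contra_neq ji => e.
      by rewrite -ry -rx e.
    by rewrite jm andbT ltn_neqAle ij andbT eq_sym.
- move=> h i mr G mi si [uG rG ra mrN im].
  exists g; split; last by rewrite /potential /= /scan_cost; lia.
  (* Occupied cells have indices between [i] and [mr], so none is left once [mr < i]. *)
  split=> //; split=> //= j; case e: (array st j) => [y|//].
  by have [_ _ /andP [ij jm] _] := ra j y e; lia.
- move=> h G x y w m' xG yG /eqP xy lk si [a0 uG rG].
  have nf : false -> rk (Defs.mem st) x = rk (Defs.mem st) y by [].
  have [g' [f' i' [r' p'] [wxy row] [H1 H2 H3]]] :=
    link_rootsP (si_forest si) xy (rG x xG) (rG y yG) nf lk.
  have yG' : y \in rem x G by rewrite mem_rem_uniq // inE eq_sym xy.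
  exists g'; split; last first.
    by rewrite /potential /= p' (size_remS xG) (size_remS yG') /=; lia.
  split; first by apply: (state_inv_ext si) => // c z; apply: H2.
  have mG z : z \in rem y (rem x G) -> [/\ z \in G, z != x & z != y].
    rewrite mem_rem_uniq ?rem_uniq // inE => /andP [zy].
    by rewrite mem_rem_uniq // inE => /andP [zx zG].
  split=> //=.
    rewrite !rem_uniq // andbT.
    by apply/negP => /mG [_ wx wy]; case: wxy wx wy => ->; rewrite eqxx.
  move=> z; rewrite inE => /orP [/eqP -> //|/mG [zF zx zy]].
  by apply: H1 => //; apply: rG.
- move=> h si [a0 _ _]; exists g; split; last by rewrite /potential /=; lia.
  split=> //; split; [exact: si_forest si|exact: si_items si|].
  move=> h' r _ /=; rewrite updE; case: eqP => // h'h H.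
  by apply: (si_heaps si) => //; case.
- move=> h x si [a0 _ rx]; exists g; split; last by rewrite /potential /=; lia.
  split=> //; split; [exact: si_forest si|exact: si_items si|].
  move=> h' r _ /=; rewrite updE; case: eqP => [->|h'h H].
    by case=> <-; apply: rx; rewrite mem_head.
  by apply: (si_heaps si) => //; case.
Qed.

(** The invariants supply what each transition requires: roots under examination are allocated, an
    occupied cell contains a different root of the same rank, and distinct full roots can always be
    linked because keys are totally ordered. *)
Lemma step_exists st k g N : good (st, k) g N -> k <> Idle -> exists c, step st k c.
Proof.
case: k => [//|h P F|h F mr|h i mr G|h G] [/= si ci] _.
- case: P ci => [|x P] [a0 uPF rP rF _]; first by eexists; constructor.
  have [px ax] := rP x (mem_head _ _); have [nx mx] := allocP ax.
  have xP := mem_head x P.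
  case: (boolP (full nx)) => fx; first by eexists; apply: keep_full_root xP mx fx.
  case lx: (Defs.last nx) => [z|]; last by eexists; apply: destroy_root xP mx fx lx.
  have [sh rg] := si_forest si.
  case kx: (kids g x) => [|f c]; first by rewrite (last_kids sh mx) kx in lx.
  have [m' e _] := pop_childP h sh kx.
  by eexists; apply: free_child xP mx fx _ e; rewrite lx.
- case: F ci => [|x F] [uF rF ra _ _]; first by eexists; constructor.
  have xF := mem_head x F; have rox := rF x xF.
  have [nx mx] := allocP (full_alloc (proj2 rox)).
  case ax: (array st (rank nx)) => [y|]; last by eexists; apply: store_root xF mx ax.
  have [yF ry _ roy] := ra _ _ ax.
  have xy : x != y by apply: contraNneq yF => <-.
  have rxy : true -> rk (Defs.mem st) x = rk (Defs.mem st) y by rewrite ry (rkE mx).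
  have [w [m' lk]] := link_exists (si_forest si) xy rox roy rxy.
  by eexists; apply: ranked_link xF mx ax lk.
- case: (leqP i mr) => im; last by eexists; apply: end_scanning.
  case ai: (array st i) => [x|]; eexists; first exact: scan_root ai.
  exact: scan_empty ai.
- case: G ci => [|x [|y G]] [a0 uG rG]; try by eexists; constructor.
  have xG : x \in [:: x, y & G] by rewrite mem_head.
  have yG : y \in [:: x, y & G] by rewrite !inE eqxx orbT.
  have xy : x != y by move: uG; rewrite /= inE negb_or => /andP [/andP []].
  have nf : false -> rk (Defs.mem st) x = rk (Defs.mem st) y by [].
  have [w [m' lk]] := link_exists (si_forest si) xy (rG x xG) (rG y yG) nf.
  by eexists; apply: unranked_link xG yG (elimN eqP xy) lk.
Qed.

End Steps.

(** * Beginnings of operations and the amortized bound *)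

Section Operations.
Context {disp : Order.disp_t} {K : orderType disp} {I : eqType}.
Implicit Types (st : state K I) (m : memory K I) (x y z u v w l r : loc).
Implicit Types (g : ghost) (h : handle) (o : op K I).

Lemma heap_root st g h : state_inv None st g ->
  forall q : option loc, heaps st h = Some q ->
  oroot_at (Defs.mem st) g h q.
Proof. by move=> si q hq x xq; apply: (si_heaps si) => //; rewrite hq xq. Qed.

Lemma itm_node st g e u : state_inv None st g -> node_of st e = Some u ->
  itm (Defs.mem st) u = Some e.
Proof. by move=> si; move/(si_items si). Qed.

Lemma itm_full m x (e : I) : itm m x = Some e -> full_at m x.
Proof. by rewrite /full_at => ->. Qed.

(** Reachability from [r] is closed under taking children; this turns the list that measures the
    heap into the closed set used to bound ranks. *)
Lemma heap_nodes st g h r N : state_inv None st g ->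
  heaps st h = Some (Some r) -> heap_size st h N ->
  exists s, [/\ size s = N, closed g s &
    forall x, in_tree (Defs.mem st) r x -> x \in s].
Proof.
move=> si hr; rewrite /heap_size hr => -[s [_ sE sN]]; exists s; split=> //.
  move=> x u px /sE us; apply/sE; apply: in_tree_child us _.
  have sh := proj1 (si_forest si).
  by apply/(child_ofP _ _ sh); rewrite (sh_par sh) px.
by move=> x /sE.
Qed.

(** The nodes of the heap are filtered out of the finite list [dom g]. Reachability is not a boolean
    predicate, hence the classical case distinction. *)
Lemma heap_size_exists st g h : state_inv None st g -> exists N, heap_size st h N.
Proof.
move=> si; rewrite /heap_size; case hr: (heaps st h) => [[r|]|]; try by exists 0.
have [sh rg] := si_forest si; have [_ fr] := heap_root si hr erefl.
have [s [us sE]] : exists s : seq loc,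
    uniq s /\ forall x, x \in s <-> x \in dom g /\ in_tree (Defs.mem st) r x.
  elim: (dom g) (sh_uniq sh) => [_|x d IH /= /andP [xd /IH [s [us sE]]]].
    by exists [::]; split=> // x; split=> // -[].
  have [tx|ntx] := classic (in_tree (Defs.mem st) r x); last first.
    exists s; split=> // y; rewrite inE.
    split=> [/sE [yd ty]|[/orP [/eqP ->|yd] ty]] //.
      by rewrite yd orbT.
    exact/sE.
  exists (x :: s); split=> [|y].
    by rewrite /= us andbT; apply: contra xd => /sE [].
  rewrite !inE; split=> [/orP [/eqP ->|/sE [yd ty]]|[/orP [/eqP ->|yd] ty]].
  - by rewrite eqxx.
  - by rewrite yd orbT.
  - by rewrite eqxx.
  - by apply/orP; right; apply/sE.
exists (size s), s; split=> // x; rewrite sE; split=> [[]//|tx]; split=> //.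
by rewrite (sh_dom sh); apply: in_tree_alloc sh (full_alloc fr) tx.
Qed.

Lemma delete_good st g e h r u c N : state_inv None st g ->
  (forall i, array st i = None) -> heaps st h = Some (Some r) ->
  node_of st e = Some u -> in_tree (Defs.mem st) r u -> heap_size st h N ->
  delete_item st e h c ->
  exists g', good c g' N /\
    potential c.1 g' N c.2 < 4 * phi (Defs.mem st) g + 25 * (trunc_log 2 N).+1.
Proof.
move=> si a0 hr ne tu hN dc.
have [s [sN cs ss]] := heap_nodes si hr hN.
have [sh rg] := si_forest si.
have fu := itm_full (itm_node si ne).
have ru : rk (Defs.mem st) u <= max_rank N.
  by rewrite -sN; apply: rank_bound (si_forest si) _ cs (ss u tu); rewrite fu.
have [m1 e1 [f1 i1 r1 p1]] := hollowP (si_forest si) fu.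
have [pr fr] := heap_root si hr erefl.
have it : inverse (itm m1) (upd (node_of st) e None).
  by apply: inverse_ext (inverse_remove (si_items si) ne).
exists g; case: dc => [r' u' m'|r' m']; rewrite hr ne => -[<-] -[].
  (* A node reached from [r] and different from it has a parent, so it is the root of no heap and
     emptying it leaves all roots full. *)
  move=> <- /(in_tree_kid sh tu) [p pu]; rewrite e1 => -[<-]; split.
    split=> //; split=> //= h' r2 _ /(heap_root si) /(_ _ erefl) [pr2 fr2].
    split=> //; rewrite /full_at i1 updE; case: eqP => // e2.
    by move: pr2; rewrite e2 pu.
  by rewrite /potential /= p1; move: ru; rewrite /max_rank; lia.
move=> ur; subst r; rewrite e1 => -[<-]; split; last first.
  (* With L for [trunc_log 2 N], the rank of the emptied root is at most 2L + 1, which adds at most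
     8L + 4 to the potential; the initial credit is 12L + 20. The sum 20L + 24 is less than 25(L +
     1), which is where 25 comes from. *)
  rewrite /potential /= p1 /link_cost /scan_cost.
  by move: ru; rewrite /max_rank; lia.
split; split=> //=.
- move=> h' r2 hh' /(heap_root si) /(_ _ erefl) [pr2 fr2].
  split=> //; rewrite /full_at i1 updE; case: eqP => // e2.
  by case: hh'; move: pr2; rewrite e2 pr => -[->].
- move=> x; rewrite inE => /eqP ->; split=> //.
  by rewrite -(sh_dom (proj1 f1)) (sh_dom sh) full_alloc.
- by exists s; split=> // x; rewrite inE => /eqP ->; apply: ss.
Qed.

Lemma delete_exists st g e h r u : state_inv None st g ->
  heaps st h = Some (Some r) -> node_of st e = Some u ->
  exists c, delete_item st e h c.
Proof.
move=> si hr ne.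
have [m' e' _] := set_itemP None (full_alloc (itm_full (itm_node si ne))).
case: (eqVneq u r) => [ur|/eqP ur]; eexists.
  by rewrite ur in ne e'; apply: delete_root hr ne e'.
exact: delete_nonroot hr ne ur e'.
Qed.

(** A meld raises [phi] by at most 1 and a decrease-key by at most 3, two units for the moved item
    and one for the link, that is 12 credits; deletions are covered by [delete_good]. *)
Lemma invoke_good st g o N c : state_inv None st g ->
  (forall i, array st i = None) -> enabled st o -> op_size st o N ->
  invoke st o c ->
  exists g', good c g' N /\
    potential c.1 g' N c.2 < 4 * phi (Defs.mem st) g + amortized_bound 25 (o, N).
Proof.
move=> si a0 en os ivk; have hroot := heap_root si.
case: ivk en os => {o c} /=.
- move=> h hN _; exists g.
  split; last by rewrite /potential /amortized_bound /=; lia.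
  split=> //; split=> /=; [exact: si_forest si|exact: si_items si|].
  by move=> h' r _; rewrite updE; case: eqP => // _ H; apply: hroot H _ erefl.
- move=> h _ _ _; exists g.
  split; last by rewrite /potential /amortized_bound /=; lia.
  by split=> //; apply: (state_inv_ext si) => //; apply: si_forest si.
- move=> h r nr _ _ _ _; exists g.
  split; last by rewrite /potential /amortized_bound /=; lia.
  by split=> //; apply: (state_inv_ext si) => //; apply: si_forest si.
- move=> e k h r x r' m' hr mx me [_ ne] _.
  have [f1 i1 p1] := forest_add h e k (si_forest si) mx.
  set m1 := upd _ x _ in f1 i1 p1 me; set g1 := add_node g x h 0 in f1 p1.
  have fold z a : root_at (Defs.mem st) g a z -> z != x /\ root_at m1 g1 a z.
    move=> [pz fz]; have zx : z != x.
      by apply: contraTneq fz => ->; rewrite /full_at /itm mx.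
    by rewrite /root_at /full_at i1 /= !updE (negPf zx).
  have rx : oroot_at m1 g1 h (Some x).
    by move=> z [<-]; rewrite /root_at /full_at i1 /= !updE eqxx.
  have rr : oroot_at m1 g1 h r by move=> z /(hroot h r hr) /fold [].
  have [|g' [f' i' p' r2 t']] := meldP h f1 rx rr _ me.
    (* The address [x] was free, whereas a root is allocated. *)
    by left=> e1; have [] := fold x h (hroot h r hr x (esym e1)); rewrite eqxx.
  exists g'; split; last by rewrite /potential /amortized_bound /=; lia.
  split=> //; split=> //=.
    apply: inverse_ext (inverse_add (si_items si) _ ne) => //; last by rewrite /itm mx.
    by move=> z; rewrite i' i1.
  move=> h' r0 _; rewrite updE; case: eqP => [-> [e1]|hh H]; first exact: r2.
  have [zx [pz fz]] := fold _ _ (hroot h' _ H r0 erefl).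
  by split; [apply: t'|rewrite (full_eq (i' r0))].
- move=> h r nr e c hr mr ie dc _ os.
  have ir : itm (Defs.mem st) r = Some e by rewrite /itm mr.
  by apply: delete_good hr _ (in_tree_root _ _) os dc => //; apply/(si_items si).
- move=> h1 h2 r1 r2 r' m' hr1 hr2 me [h12 _ _] _.
  have ro1 := hroot _ _ hr1; have ro2 := hroot _ _ hr2.
  have [|g' [f' i' p' r3 t']] := meldP h1 (si_forest si) ro1 ro2 _ me.
    (* A common root would carry both labels [h1] and [h2]. *)
    case: (r1) ro1 => [x|] ro1; [left=> e|by right].
    have [p1 _] := ro1 x erefl; have [p2 _] := ro2 x (esym e).
    by case: h12; move: p1; rewrite p2 => -[].
  exists g'; split; last by rewrite /potential /amortized_bound /=; lia.
  split=> //; split=> //=; first exact: inverse_ext (si_items si).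
  move=> h r _; rewrite !updE; case: eqP => [-> [e]|n1]; first exact: r3.
  case: eqP => // n2 H; have [pr fr] := hroot h _ H r erefl.
  by split; [apply: t'|rewrite (full_eq (i' r))].
- move=> e k h r m' hr ne sk _ _.
  have [m1 + [a1 i1 r1 l1 n1]] := set_keyP k (full_alloc (itm_full (itm_node si ne))).
  rewrite sk => -[e1]; subst m1.
  have [f1 p1] := forest_ext a1 i1 r1 l1 n1 (si_forest si).
  exists g; split; last by rewrite /potential /amortized_bound /= p1; lia.
  by split=> //; apply: (state_inv_ext si).
- move=> e k h r u nu v m1 m2 r' m' hr ne ur mu mv e1 e2 me [u' [nu' [ih _ _]]] _.
  case: ih => r0; rewrite hr => -[<-]; rewrite ne => -[<-] tu.
  have [p pu] := in_tree_kid (proj1 (si_forest si)) tu ur.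
  have iu := itm_node si ne.
  have [m1' [m2' [g2 [+ + [f2 i2 p2 pv t2]]]]] :=
    decreaseP h e k (si_forest si) mu (itm_full iu) pu mv.
  rewrite e1 => -[e3]; subst m1'; rewrite e2 => -[e4]; subst m2'.
  have uv : u != v by apply: contraTneq (itm_full iu) => ->; rewrite /full_at /itm mv.
  have fold z a : root_at (Defs.mem st) g a z -> z != v /\ root_at m2 g2 a z.
    move=> [pz fz]; have zv : z != v.
      by apply: contraTneq fz => ->; rewrite /full_at /itm mv.
    have zu : z != u by apply: contra_eq_neq pz => ->; rewrite pu.
    split=> //; split; first exact: t2.
    by rewrite /full_at i2 !updE (negPf zu) (negPf zv).
  have rv : oroot_at m2 g2 h (Some v).
    move=> z [<-]; split=> //.
    by rewrite /full_at i2 !updE eq_sym (negPf uv) eqxx.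
  have [rnv rr] := fold _ _ (hroot h _ hr r erefl).
  have rr' : oroot_at m2 g2 h (Some r) by move=> z [<-].
  have [|g' [f' i' p' r3 t']] := meldP h f2 rv rr' _ me.
    by left=> -[e3]; rewrite e3 eqxx in rnv.
  exists g'; split; last by rewrite /potential /amortized_bound /=; lia.
  split=> //; split=> //=.
    (* The item is removed from [u], then added at [v]; the memory was updated in the other order,
       which agrees because [u != v]. *)
    apply: inverse_ext (inverse_add (x := v) (e := e)
      (inverse_remove (si_items si) ne) _ _).
    + move=> z; rewrite i' i2 !updE; case: (eqVneq z u) => // ->.
      by rewrite (negPf uv).
    + by move=> z; rewrite !updE; case: eqP.
    + by rewrite updE /itm mv; case: eqP.
    + by rewrite updE eqxx.
  move=> h' r2 _; rewrite updE; case: eqP => [-> [e3]|hh H]; first exact: r3.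
  have [zx [pz fz]] := fold _ _ (hroot h' _ H r2 erefl).
  by split; [apply: t'|rewrite (full_eq (i' r2))].
- move=> e h c dc [u [r hr ne tu]] os.
  exact: delete_good hr ne tu os dc.
Qed.

(** Only the finitely many addresses in [dom g] are allocated, so the successor of their maximum is
    free. *)
Lemma fresh_loc m g : shape m g -> exists x, m x = None.
Proof.
move=> sh; exists (\max_(x <- dom g) x).+1.
case e: (m _) => [n|//].
have : (\max_(x <- dom g) x).+1 \in dom g by rewrite (sh_dom sh) /alloc e.
by move/(leq_bigmax_seq (F := id)) => /(_ predT isT); rewrite ltnn.
Qed.

Lemma invoke_exists st g o : state_inv None st g -> enabled st o ->
  exists N c, op_size st o N /\ invoke st o c.
Proof.
move=> si; have hroot := heap_root si; have [sh rg] := si_forest si.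
case: o => [h|h|e k h|h|h1 h2|e k h|e h] /=.
- by move=> hN; exists 0; eexists; split=> //; constructor.
- case hr: (heaps st h) => [[r|]|//] _; exists 0; last first.
    by eexists; split=> //; apply: do_find_min_empty.
  have [_ fr] := hroot _ _ hr r erefl; have [n mr] := allocP (full_alloc fr).
  by eexists; split=> //; apply: do_find_min hr mr.
- move=> [hN ne]; case hr: (heaps st h) hN => [r|//] _.
  have [x mx] := fresh_loc sh.
  have [f1 i1 p1] := forest_add h e k (si_forest si) mx.
  set m1 := upd _ x _ in f1 i1; set g1 := add_node g x h 0 in f1.
  have fold z : root_at (Defs.mem st) g h z -> z != x /\ root_at m1 g1 h z.
    move=> [pz fz]; have zx : z != x.
      by apply: contraTneq fz => ->; rewrite /full_at /itm mx.
    by rewrite /root_at /full_at i1 /= !updE (negPf zx).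
  have rx : oroot_at m1 g1 h (Some x).
    by move=> z [<-]; rewrite /root_at /full_at i1 /= !updE eqxx.
  have rr : oroot_at m1 g1 h r by move=> z /(hroot h r hr) /fold [].
  have [|r' [m' me]] := meld_exists f1 rx rr.
    by left=> e1; have [] := fold x (hroot h r hr x (esym e1)); rewrite eqxx.
  by exists 0; eexists; split=> //; apply: do_insert hr mx me.
- move=> [r hr]; have [N hN] := heap_size_exists h si; exists N.
  have [pr fr] := hroot _ _ hr r erefl; have [n mr] := allocP (full_alloc fr).
  move: fr; rewrite /full_at /itm mr; case ie: (item n) => [e|//] _.
  have ne : node_of st e = Some r by apply/(si_items si); rewrite /itm mr.
  have [c dc] := delete_exists si hr ne.
  by exists c; split=> //; apply: do_delete_min hr mr ie dc.
- case hr1: (heaps st h1) => [r1|]; last by case.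
  case hr2: (heaps st h2) => [r2|]; last by case.
  move=> [h12 _ _]; have ro1 := hroot _ _ hr1; have ro2 := hroot _ _ hr2.
  have [|r' [m' me]] := meld_exists (si_forest si) ro1 ro2.
    case: (r1) ro1 => [x|] ro1; [left=> e|by right].
    have [p1 _] := ro1 x erefl; have [p2 _] := ro2 x (esym e).
    by case: h12; move: p1; rewrite p2 => -[].
  by exists 0; eexists; split=> //; apply: do_meld hr1 hr2 me.
- move=> [u [nu [[r hr ne tu] mu _]]]; exists 0.
  have iu := itm_node si ne.
  case: (eqVneq u r) => [ur|/eqP ur].
    rewrite ur in ne iu.
    have [m' e' _] := set_keyP k (full_alloc (itm_full iu)).
    by eexists; split=> //; apply: do_decrease_key_root hr ne e'.
  have [p pu] := in_tree_kid sh tu ur.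
  have [v mv] := fresh_loc sh.
  have [m1 [m2 [g2 [e1 e2 [f2 i2 p2 pv t2]]]]] :=
    decreaseP h e k (si_forest si) mu (itm_full iu) pu mv.
  have uv : u != v by apply: contraTneq (itm_full iu) => ->; rewrite /full_at /itm mv.
  have [pr fr] := hroot _ _ hr r erefl.
  have rv : r != v by apply: contraTneq fr => ->; rewrite /full_at /itm mv.
  have ru : r != u by apply: contra_eq_neq pr => ->; rewrite pu.
  have rov : oroot_at m2 g2 h (Some v).
    move=> z [<-]; split=> //.
    by rewrite /full_at i2 !updE eq_sym (negPf uv) eqxx.
  have ror : oroot_at m2 g2 h (Some r).
    move=> z [<-]; split; first exact: t2.
    by rewrite /full_at i2 !updE (negPf ru) (negPf rv).
  have [|r' [m' me]] := meld_exists f2 rov ror.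
    by left=> -[e3]; rewrite e3 eqxx in rv.
  by eexists; split=> //; apply: do_decrease_key hr ne ur mu mv e1 e2 me.
- move=> [u [r hr ne tu]]; have [N hN] := heap_size_exists h si; exists N.
  have [c dc] := delete_exists si hr ne.
  by exists c; split=> //; apply: do_delete.
Qed.

Definition empty_ghost : ghost :=
  Ghost [::] (fun=> [::]) (fun=> inr 0) (fun=> 0).

Lemma initial_good : good (initial : state K I, Idle) empty_ghost 0.
Proof. by split=> //; split=> //; split. Qed.

(** The sum of time and potential stays within the budget: a transition within a deletion is paid by
    the potential, the beginning of an operation by its amortized bound. The listed [N] accompanies
    a deletion to its end. *)
Lemma execution_good (l : seq (op K I * nat)) t c : execution l t c ->
  exists g N, good c g N /\
    t + potential c.1 g N c.2 <= \sum_(p <- l) amortized_bound 25 p.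
Proof.
elim=> {l t c} [|l t st o N c _ [g [N0 [[/= si a0] le]]] en os ivk|
    l t st k c _ [g [N [gd le]]] sk].
- exists empty_ghost, 0.
  by split; [exact: initial_good|rewrite /potential /phi /= !big_nil].
- have [g' [gd lt]] := invoke_good si a0 en os ivk.
  exists g', N; split=> //; rewrite -cats1 big_cat big_seq1 /=.
  (* An idle machine has credit 0, so its potential is 4 times [phi], whatever [N0] is. *)
  by move: le lt; rewrite {1}/potential /= addn0; lia.
- have [g' [gd' lt]] := step_good gd sk.
  by exists g', N; split=> //; move: le lt => /=; lia.
Qed.

Lemma good_can_proceed (c : config K I) g N : good c g N -> can_proceed c.
Proof.
case: c => st [|h P F|h F mr|h i mr G|h G] gd; try exact: (step_exists gd).
by move=> o; apply: invoke_exists (proj1 gd).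
Qed.

End Operations.

Theorem theorem3p4 :
  exists C : nat,
  forall (disp : Order.disp_t) (K : orderType disp) (I : eqType)
         (l : seq (op K I * nat)) (t : nat) (c : config K I),
  execution l t c ->
  t <= \sum_(p <- l) amortized_bound C p /\ can_proceed c.
Proof.
exists 25 => disp K I l t c /execution_good [g [N [gd le]]].
split; first exact: leq_trans (leq_addr _ _) le.
exact: good_can_proceed gd.
Qed.
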